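(* Fix two skew lines $\ell_1$ and $\ell_2$ in $\mathbb{P}^3=\mathbb{P}^3_{\mathbb{C}}$ and a general quadric $Q$ in $\mathbb{P}^3$ (that is, a quadric $Q$ whose associated $(2,2)$-form $F_Q$ is not identically zero and defines a smooth $(2,2)$-curve in $\mathbb{P}^1\times\mathbb{P}^1$). Then the closure, in the $\mathbb{P}^9$ of quadrics, of the set of quadrics $Q'$ with $F_{Q'}\not\equiv 0$ for which there are infinitely many lines simultaneously transversal to $\ell_1$ and $\ell_2$ and tangent to both $Q$ and $Q'$ is a curve of degree $24$. This curve consists of $12$ plane conics.
   Context: The ground field is $\mathbb{C}$. A quadric in $\mathbb{P}^3$ is identified with a nonzero symmetric $4\times 4$ matrix $Q$ up to scaling (its equation is $v^{\mathrm T}Qv=0$), so the space of quadrics is $\mathbb{P}^9$. A line is transversal to another line if it meets it. A line is tangent to a quadric if the restriction of the quadratic form to the line is singular, i.e. either it has a double root or it vanishes identically. Write $\ell_1=\{wa+xb : [w,x]\in\mathbb{P}^1\}$ and $\ell_2=\{yc+zd : [y,z]\in\mathbb{P}^1\}$ with $a,b,c,d$ spanning $\mathbb{P}^3$. Lines meeting both $\ell_1$ and $\ell_2$ are identified with points $([w,x],[y,z])\in\mathbb{P}^1\times\mathbb{P}^1$. The Plücker vector of the line through $u,v\in\mathbb{P}^3$ is $p=(p_{01},p_{02},p_{03},p_{12},p_{13},p_{23})^{\mathrm T}$, $p_{ij}=u_iv_j-u_jv_i$. Let $p_\ell(w,x,y,z)$ be the Plücker vector of the line through $wa+xb$ and $yc+zd$.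 For a matrix $A$, $\wedge^2A$ is the matrix of its $2\times 2$ minors, with rows and columns indexed by $2$-element subsets. The $(2,2)$-form of a quadric $Q$ is $$F_Q(w,x,y,z)=p_\ell(w,x,y,z)^{\mathrm T}(\wedge^2Q)\,p_\ell(w,x,y,z),$$ a bihomogeneous form of bidegree $(2,2)$ in $(w,x),(y,z)$; the transversal $\ell$ is tangent to $Q$ iff $F_Q$ vanishes at the corresponding point. A $(2,2)$-curve is the zero set of a nonzero bihomogeneous form of bidegree $(2,2)$; it is smooth if the gradient of the form does not vanish at any point of the curve. *)

(* Defs.v *)
(* The complex numbers are R[i] for R : realType; the definitions are given over
   an arbitrary field K. *)
From HB Require Import structures.
From mathcomp Require Import all_boot all_order all_algebra.
From mathcomp Require Import boolp classical_sets cardinality reals.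
From mathcomp Require Import mpoly complex.

Set Implicit Arguments.
Unset Strict Implicit.
Unset Printing Implicit Defensive.

Import GRing.Theory.
Local Open Scope ring_scope.
Local Open Scope classical_set_scope.

Section Projective.
Variable K : fieldType.

(* Points of P^n are the lines through the origin of K^(n+1), and lines of P^n
   the planes through the origin; {vspace _} is canonical, so equality here is
   equality of points (lines) and cardinalities are the geometric ones. *)
Definition point (n : nat) := {p : {vspace 'rV[K]_n.+1} | \dim p == 1%N}.
Definition line (n : nat) := {l : {vspace 'rV[K]_n.+1} | \dim l == 2%N}.

Variable n : nat.

Definition coords (p : point n) : 'rV[K]_n.+1 := vpick (val p).

Definition vanishes (f : {mpoly K[n.+1]}) (p : point n) : Prop :=
  forall v, v \in val p -> f.@[v ord0] = 0.

Definition zariski_closed (X : set (point n)) : Prop :=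
  exists S : set {mpoly K[n.+1]},
    (forall f, S f -> exists d : nat, f \is d.-homog) /\
    X = [set p | forall f, S f -> vanishes f p].

Definition zariski_closure (X : set (point n)) : set (point n) :=
  smallest zariski_closed X.

Definition irreducible_set (Z : set (point n)) : Prop :=
  Z !=set0 /\
  forall Y1 Y2, zariski_closed Y1 -> zariski_closed Y2 ->
    Z `<=` Y1 `|` Y2 -> Z `<=` Y1 \/ Z `<=` Y2.

Definition irreducible_closed (Z : set (point n)) : Prop :=
  zariski_closed Z /\ irreducible_set Z.

(* A chain Z_0 < ... < Z_m of irreducible closed subsets of X, of length m. *)
Definition has_chain (X : set (point n)) (m : nat) : Prop :=
  exists Z : nat -> set (point n),
    (forall i, (i <= m)%N -> irreducible_closed (Z i) /\ Z i `<=` X) /\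
    (forall i, (i < m)%N -> Z i `<` Z i.+1).

Definition has_dim (X : set (point n)) (m : nat) : Prop :=
  has_chain X m /\ ~ has_chain X m.+1.

Definition irreducible_component (X Z : set (point n)) : Prop :=
  [/\ irreducible_closed Z, Z `<=` X &
      forall Z', irreducible_closed Z' -> Z' `<=` X -> Z `<=` Z' -> Z' = Z].

Definition is_curve (X : set (point n)) : Prop :=
  [/\ zariski_closed X, X !=set0 &
      forall Z, irreducible_component X Z -> has_dim Z 1].

(* Hyperplanes are parametrized by the dual P^n. *)
Definition hyperplane (h : point n) : set (point n) :=
  [set p : point n | forall v : 'rV_n.+1, v \in val p ->
     \sum_i coords h ord0 i * v ord0 i = 0].

(* The degree of a curve: the number of points of its intersection with a
   general hyperplane, i.e. one outside a proper closed subset B of the dual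
   projective space. *)
Definition curve_degree (X : set (point n)) (d : nat) : Prop :=
  exists2 B : set (point n), zariski_closed B /\ B <> setT &
    forall h, ~ B h -> (X `&` hyperplane h #= `I_d)%card.

(* An irreducible plane curve of degree two, so that pairs of lines and double
   lines are excluded. *)
Definition plane_conic (X : set (point n)) : Prop :=
  [/\ is_curve X, irreducible_set X, curve_degree X 2 &
      exists2 W : {vspace 'rV[K]_n.+1},
        \dim W = 3%N & forall p, X p -> (val p <= W)%VS].

End Projective.

Section Quadrics.
Variable K : fieldType.

(* Coordinates on the P^9 of quadrics are the entries q_ij, i <= j, of the
   symmetric matrix, in lexicographic order. *)
Definition upper_pairs : seq (nat * nat) :=
  [:: (0, 0); (0, 1); (0, 2); (0, 3); (1, 1);
      (1, 2); (1, 3); (2, 2); (2, 3); (3, 3)]%N.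

Definition sym_mx (q : 'rV[K]_10) : 'M[K]_4 :=
  \matrix_(i, j) q ord0 (inord (index (minn i j, maxn i j) upper_pairs)).

Lemma sym_mx_inj : injective sym_mx.
Proof.
move=> q q' /matrixP eqq; apply/rowP => k.
pose ij := nth (0, 0)%N upper_pairs k.
have /andP[le_ij lt_j] : (ij.1 <= ij.2 < 4)%N.
  by apply: (@all_nthP _ [pred p | p.1 <= p.2 < 4]%N upper_pairs (0, 0)%N isT).
have lt_i := leq_ltn_trans le_ij lt_j.
have := eqq (inord ij.1) (inord ij.2); rewrite !mxE !inordK //.
rewrite (minn_idPl le_ij) (maxn_idPr le_ij) -surjective_pairing.
by rewrite index_uniq // inord_val.
Qed.

Lemma sym_mxP (A : 'M[K]_4) : A^T = A <-> exists q, A = sym_mx q.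
Proof.
split=> [symA | [q ->]]; last by apply/matrixP=> i j; rewrite !mxE minnC maxnC.
exists (\row_k A (inord (nth (0, 0)%N upper_pairs k).1)
                 (inord (nth (0, 0)%N upper_pairs k).2)).
apply/matrixP => i j; rewrite !mxE.
have ij_in : (minn i j, maxn i j) \in upper_pairs.
  by case: i j => [[|[|[|[|i]]]] //= _] [[|[|[|[|j]]]] //= _].
rewrite inordK; last by rewrite -index_mem in ij_in.
rewrite nth_index //=.
have [le_ij | /ltnW le_ji] := leqP i j; first by rewrite !inord_val.
by rewrite !inord_val -{1}symA mxE.
Qed.

Definition quadric := point K 9.

(* Determined up to a nonzero scalar, as the quadric is. *)
Definition quadric_mx (Q : quadric) : 'M[K]_4 := sym_mx (coords Q).

Definition skew_lines (l m : line K 3) : Prop := (val l :&: val m)%VS = 0%VS.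

Definition transversal_line (l m : line K 3) : Prop :=
  (val l :&: val m)%VS <> 0%VS.

(* The restriction of the quadratic form to the line l is singular, that is,
   its polar form restricted to l has a nonzero radical. *)
Definition tangent (l : line K 3) (Q : quadric) : Prop :=
  exists2 u, u \in val l & u != 0 /\
    forall v, v \in val l -> u *m quadric_mx Q *m v^T = 0.

(* The 2-element subsets of {0,1,2,3}, with 'I_4 read as the ring Z/4. *)
Definition pairs : seq ('I_4 * 'I_4) :=
  [:: (0, 1); (0, 2); (0, 3); (1, 2); (1, 3); (2, 3)].

Definition idx2 (I : 'I_6) : 'I_4 * 'I_4 := nth (0, 0) pairs I.

End Quadrics.

Definition pluecker (A : comNzRingType) (u v : 'rV[A]_4) : 'cV[A]_6 :=
  \col_I let: (i, j) := idx2 I in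
    u ord0 i * v ord0 j - u ord0 j * v ord0 i.

Definition wedge2 (A : comNzRingType) (M : 'M[A]_4) : 'M[A]_6 :=
  \matrix_(I, J) let: (i, i') := idx2 I in let: (j, j') := idx2 J in
    M i j * M i' j' - M i j' * M i' j.

Section TangentForm.
Variable K : fieldType.
Local Notation S := {mpoly K[4]}.

(* The variables w, x, y, z are 'X_0, 'X_1, 'X_2, 'X_3. *)
Definition pluecker_transversal (a b c d : 'rV[K]_4) : 'cV[S]_6 :=
  let cst := map_mx (@mpolyC 4 K) in
  pluecker ('X_0 *: cst a + 'X_1 *: cst b) ('X_2 *: cst c + 'X_3 *: cst d).

Definition form22 (a b c d : 'rV[K]_4) (Q : quadric K) : S :=
  let p := pluecker_transversal a b c d in
  (p^T *m wedge2 (map_mx (@mpolyC 4 K) (quadric_mx Q)) *m p) ord0 ord0.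

(* Points ([w,x],[y,z]) of P^1 x P^1 are represented by homogeneous
   coordinates v = (w,x,y,z). *)
Definition smooth22 (F : S) : Prop :=
  forall v : 'I_4 -> K,
    (v 0 != 0) || (v 1 != 0) -> (v 2 != 0) || (v 3 != 0) ->
    F.@[v] = 0 -> exists i, (F^`M(i)).@[v] != 0.

End TangentForm.

(* Main.v *)
Require Import Defs.
From HB Require Import structures.
From mathcomp Require Import all_boot all_order all_algebra.
From mathcomp Require Import boolp classical_sets cardinality reals.
From mathcomp Require Import mpoly complex.
From mathcomp Require Import separable ring.

Set Implicit Arguments.
Unset Strict Implicit.
Unset Printing Implicit Defensive.

Import Defs Order.TTheory GRing.Theory Num.Theory.
Local Open Scope ring_scope.
Local Open Scope classical_set_scope.

(** In a basis of K^4 whose first two vectors span l1 and whose last two span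
    l2, a quadric consists of a quadratic form al on l1, a quadratic form ga on
    l2 and a bilinear form be pairing them, and its (2,2)-form is the Gram
    determinant F = al ga - be^2.

    Two quadrics Q and Q' have infinitely many common tangents among the
    transversals iff F_Q and F_Q' share a component.  As F_Q is smooth, hence
    irreducible, and both forms have bidegree (2,2), this means that F_Q' is a
    nonzero multiple of F_Q.  The elementary version used here
    ([common_component]) is that the resultant of two such forms vanishes
    identically only if they are proportional: otherwise the discriminant of F_Q
    would be a square, whereas smoothness makes its roots simple.

    The question becomes to find all al, ga, be with al ga - be^2 = lam F.
    Regard F as a quadratic form on l2 depending on a point of l1.  Its
    discriminant D is a quartic form on l1 with four distinct roots, the branch
    points ([smooth_discriminant_simple]).  Taking discriminants in the equation
    shows that al divides D, so al vanishes at two distinct branch points p and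
    p' ([solution_roots]).  At p the equation says that lam F(p, _) =
    - be(p, _)^2, which determines be(p, _) up to sign; the same holds at p', and
    be, being linear on l1, is determined by its values at p and p'.  Conversely
    any choice of two branch points and of the signs yields a solution
    ([solution_through]): lam F + be^2 then vanishes at p and p', hence is the
    product of al and a form on l2.

    If (al, be, ga) is a solution, then s^2 al, s t be, t^2 ga form one as well, for
    all nonzero s and t.  In particular be and - be belong to the same family, so
    only the relative sign at p and p' matters and there are 6 * 2 = 12 families
    ([pencil_solutions]).  Each is a plane conic in P^9 without the two points
    s t = 0, at which the (2,2)-form vanishes.  So the closure is the union of
    twelve conics ([twelve_conics]).

    The geometry of such a union rests on one fact: a closed set contains a conic
    or meets it in finitely many points ([conic_meets_closed]), because the
    equations of the closed set pull back to binary forms on the parametrized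
    conic.  This gives that conics are irreducible of dimension 1 and that
    distinct conics have finitely many common points.  A general hyperplane
    avoids these points and meets each conic twice, whence the degree
    ([conic_union_degree]). *)

(** * Polynomials over an algebraically closed field *)

Lemma infinite_range T U (f : T -> U) (A : set T) :
  {in A &, injective f} -> infinite_set A -> infinite_set (f @` A).
Proof. by move=> /inj_card_eq/eq_finite_set ->. Qed.

Section ClosedField.
Variable K : numClosedFieldType.

Lemma roots_seq (P : {poly K}) : P != 0 -> exists r : seq K, forall t, root P t -> t \in r.
Proof.
have [r defP] := closed_field_poly_normal P => P0; exists r => t.
by rewrite defP rootZ ?lead_coef_eq0 // root_prod_XsubC.
Qed.

Lemma infinite_field : infinite_set [set: K].
Proof.
apply: (@sub_infinite_set _ (range (fun i : nat => i%:R : K))) => //.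
apply: infinite_range infinite_nat => i j _ _ /eqP.
by rewrite eqr_nat => /eqP.
Qed.

Lemma exists_notin (r : seq K) : exists t, t \notin r.
Proof.
apply: contrapT => all_in; apply: infinite_field.
apply: sub_finite_set (finite_seq r) => t _ /=.
by apply: contrapT => t_notin; apply: all_in; exists t; apply/negP.
Qed.

Lemma poly_eq0_cofinite (P : {poly K}) (r : seq K) :
  (forall t, t \notin r -> P.[t] = 0) -> P = 0.
Proof.
move=> Pr; apply/eqP/negPn/negP => /roots_seq[r' Pr'].
have [t] := exists_notin (r ++ r'); rewrite mem_cat negb_or => /andP[tr].
by rewrite Pr' // rootE Pr.
Qed.

(** Along a parametrized rational curve a form becomes a univariate polynomial,
    whose zeros are finite in number unless it is zero. *)
Lemma meval_along n (f : {mpoly K[n]}) (g : 'I_n -> {poly K}) :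
  exists P : {poly K}, forall t, P.[t] = f.@[fun i => (g i).[t]].
Proof.
exists (\sum_(m <- msupp f) f@_m *: \prod_i g i ^+ m i) => t.
rewrite mevalE horner_sum; apply: eq_bigr => m _.
rewrite hornerZ horner_prod; congr (_ * _).
by apply: eq_bigr => i _; rewrite horner_exp.
Qed.

Lemma meval_homog n (f : {mpoly K[n]}) d (v : 'I_n -> K) c :
  f \is d.-homog -> f.@[fun i => c * v i] = c ^+ d * f.@[v].
Proof.
move=> /dhomogP fd; rewrite !mevalE mulr_sumr; apply: eq_big_seq => m /fd <-.
rewrite mulrCA; congr (_ * _); rewrite /= mdegE -prodrXr -big_split /=.
by apply: eq_bigr => i _; rewrite exprMn.
Qed.

End ClosedField.

(** * Projective points and closed sets *)

Section ProjectiveSpace.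
Variables (K : numClosedFieldType) (n : nat).
Implicit Types (p q : point K n) (v : 'rV[K]_n.+1) (X Y Z : set (point K n)).
Implicit Types (f : {mpoly K[n.+1]}).

Lemma mkpoint_subproof v : v != 0 -> \dim <[v]>%VS == 1%N.
Proof. by rewrite dim_vline => ->. Qed.

Definition mkpoint v (v0 : v != 0) : point K n := exist _ <[v]>%VS (mkpoint_subproof v0).

Lemma coords_mem p : coords p \in val p.
Proof. exact: memv_pick. Qed.

Lemma coords_neq0 p : coords p != 0.
Proof. by rewrite vpick0 -dimv_eq0 (eqP (valP p)). Qed.

Lemma val_point p v : v \in val p -> v != 0 -> val p = <[v]>%VS.
Proof.
move=> pv v0; apply/esym/eqP; rewrite eqEdim -memvE pv dim_vline v0.
by rewrite (eqP (valP p)).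
Qed.

Lemma point_eq p q v : v \in val p -> v \in val q -> v != 0 -> p = q.
Proof. by move=> pv qv v0; apply: val_inj; rewrite (val_point pv) ?(val_point qv). Qed.

Lemma finite_points_through (V : seq 'rV[K]_n.+1) :
  finite_set [set p : point K n | exists2 v, v \in V & v != 0 /\ v \in val p].
Proof.
elim: V => [|v V IHV]; first by apply: (@sub_finite_set _ _ set0) => // p [].
have fin1 : finite_set [set p : point K n | v != 0 /\ v \in val p].
  have [->|v0] := eqVneq v 0; first by apply: (@sub_finite_set _ _ set0) => // p [].
  by apply: sub_finite_set (finite_set1 (mkpoint v0)) => p [_ pv];
    exact: (point_eq (q := mkpoint v0) pv (memv_line v) v0).
apply: sub_finite_set (_ : finite_set (_ `|` _)); last by rewrite finite_setU; split; [exact: fin1 | exact: IHV].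
move=> p [w]; rewrite inE => /orP[/eqP -> |wV] pw; first by left.
by right; exists w.
Qed.

Lemma coords_multiple p v : v \in val p -> v != 0 ->
  exists2 c, c != 0 & coords p = c *: v.
Proof.
move=> pv v0; have := coords_mem p; rewrite (val_point pv v0) => /vlineP[c cE].
by exists c => //; apply: contra_eq_neq cE => ->; rewrite scale0r coords_neq0.
Qed.

Lemma vanishes_homog f d p v : f \is d.-homog -> v \in val p -> v != 0 ->
  vanishes f p <-> f.@[v ord0] = 0.
Proof.
move=> fd pv v0; split=> [|fv w]; first exact.
rewrite (val_point pv v0) => /vlineP[c ->].
by rewrite (meval_eq (v2 := fun i => c * v ord0 i)) ?(meval_homog _ _ fd) ?fv ?mulr0 // => i; rewrite mxE.
Qed.

(** The union is cut out by the products of an equation of X and an equation of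
    Y. *)
Lemma zariski_closedU X Y :
  zariski_closed X -> zariski_closed Y -> zariski_closed (X `|` Y).
Proof.
move=> [S [Sh ->]] [S' [S'h ->]].
exists [set h | exists f g, [/\ S f, S' g & h = f * g]]; split.
  move=> _ [f [g [/Sh[d fd] /S'h[e ge] ->]]]; exists (d + e)%N; exact: dhomogM.
apply/seteqP; split=> p /=.
  move=> fg0 _ [f [g [Sf S'g ->]]] v pv; rewrite mevalM.
  by case: fg0 => [/(_ _ Sf _ pv) -> | /(_ _ S'g _ pv) ->]; rewrite ?mul0r ?mulr0.
move=> fg0; have [|] := pselect (forall f, S f -> vanishes f p); first by left.
move=> /existsNP[f /not_implyP[Sf fp]]; right=> g S'g.
have [[d fd] [e ge]] := (Sh _ Sf, S'h _ S'g).
have := fg0 _ (ex_intro _ f (ex_intro _ g (And3 Sf S'g erefl))).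
have pv := coords_mem p; have v0 := coords_neq0 p.
move=> /(_ _ pv); rewrite mevalM => /eqP; rewrite mulf_eq0 => /orP[] /eqP.
  by move=> /(vanishes_homog fd pv v0).
by move=> /(vanishes_homog ge pv v0).
Qed.

Definition linear_form (w : 'cV[K]_n.+1) : {mpoly K[n.+1]} := \sum_i w i 0 *: 'X_i.

Lemma linear_formE w v : (linear_form w).@[v ord0] = (v *m w) 0 0.
Proof.
by rewrite raddf_sum mxE; apply: eq_bigr => i _ /=; rewrite mevalZ mevalXU mulrC.
Qed.

Lemma linear_form_homog w : linear_form w \is 1.-homog.
Proof. by apply: rpred_sum => i _; apply: dhomogZ; rewrite dhomogX; apply/eqP; exact: mdeg1. Qed.

Lemma linear_form_col m (A : 'M[K]_(n.+1, m)) j v :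
  (linear_form (col j A)).@[v ord0] = (v *m A) 0 j.
Proof. by rewrite linear_formE colE mulmxA -colE mxE. Qed.

(** The columns of a cokernel matrix of a representative are linear equations of
    the point. *)
Lemma zariski_closed1 p : zariski_closed [set p].
Proof.
have pv := coords_mem p; have v0 := coords_neq0 p; set v := coords p in pv v0.
exists [set f | exists j, f = linear_form (col j (cokermx v))]; split.
  by move=> _ [j ->]; exists 1%N; exact: linear_form_homog.
apply/seteqP; split=> [_ -> _ [j ->]|q qS].
  apply/(vanishes_homog (linear_form_homog _) pv v0).
  by rewrite linear_form_col mulmx_coker mxE.
have /sub_rVP[c qE] : (coords q <= v)%MS.
  rewrite submxE; apply/eqP/rowP => j; rewrite -linear_form_col mxE.
  by apply: qS (coords_mem q); exists j.
apply: (point_eq (coords_mem q) _ (coords_neq0 q)).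
by rewrite qE rpredZ.
Qed.

Lemma zariski_closed0 : zariski_closed (set0 : set (point K n)).
Proof.
exists [set 1]; split=> [_ -> | ]; first by exists 0%N; exact: dhomog1.
apply/seteqP; split=> // p /(_ _ erefl _ (coords_mem p)).
by rewrite meval1 => /eqP; rewrite oner_eq0.
Qed.

Lemma zariski_closed_bigcup m (C : 'I_m -> set (point K n)) :
  (forall i, zariski_closed (C i)) -> zariski_closed (\bigcup_i C i).
Proof.
move=> Ccl; rewrite (_ : \bigcup_i C i = \big[setU/set0]_(i < m) C i).
  by elim/big_ind: _ => //; [exact: zariski_closed0 | exact: zariski_closedU].
by rewrite -bigcup_seq; apply: eq_bigcupl; split=> i //= _; exact: mem_index_enum.
Qed.

Lemma finite_closed X : finite_set X -> zariski_closed X.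
Proof.
move=> /finite_seqP[s ->]; elim: s => [|p s IHs].
  by rewrite set_nil; exact: zariski_closed0.
rewrite (_ : [set` p :: s] = [set p] `|` [set` s]).
  exact: zariski_closedU (zariski_closed1 p) IHs.
apply/seteqP; split=> q; rewrite /= inE.
  by move=> /orP[/eqP|]; [left | right].
by move=> [->|->]; rewrite ?eqxx ?orbT.
Qed.

(** Removing a point from a finite set leaves a closed set, so that an
    irreducible finite set has only one point. *)
Lemma irreducible_finite X : irreducible_set X -> finite_set X -> exists p, X = [set p].
Proof.
move=> [[p Xp] Xirr] finX; exists p; apply/seteqP; split=> [|_ -> //].
have finX' : finite_set (X `\ p) by apply: sub_finite_set finX => q [].
have [||] // := Xirr _ _ (zariski_closed1 p) (finite_closed finX').
  by move=> q Xq; have [->|qp] := pselect (q = p); [left | right].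
by move=> /(_ p Xp)[_ []].
Qed.

Lemma irreducible1 p : irreducible_set [set p].
Proof.
split; first by exists p.
by move=> Y1 Y2 _ _ /(_ p erefl)[?|?]; [left | right] => _ ->.
Qed.

End ProjectiveSpace.

(** * Conics in projective space *)

Section Conics.
Variables (K : numClosedFieldType) (n : nat).
Implicit Types (p q : point K n) (E : 'M[K]_(3, n.+1)) (Y Z : set (point K n)).

Definition veronese (s t : K) : 'rV[K]_3 := \row_i (s ^+ (2 - i) * t ^+ i).
Definition conic_vec E s t : 'rV[K]_n.+1 := veronese s t *m E.

(** The rows e0, e1, e2 of E parametrize the conic by s^2 e0 + s t e1 + t^2 e2;
    it is a smooth conic in the plane that they span as soon as they are
    independent. *)
Definition conic E : set (point K n) :=
  [set p : point K n | exists s t, conic_vec E s t != 0 /\ conic_vec E s t \in val p].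

Lemma conic_vecE E s t : conic_vec E s t =
  s ^+ 2 *: row 0 E + (s * t) *: row 1 E + t ^+ 2 *: row 2 E.
Proof.
apply/rowP => i; rewrite !mxE !big_ord_recl big_ord0 !mxE /= addr0 addrA.
rewrite !expr0 !expr1 mulr1 mul1r.
by congr (_ + _ * E _ _ + _ * E _ _); apply: val_inj.
Qed.

Lemma veroneseZ c s t : veronese (c * s) (c * t) = c ^+ 2 *: veronese s t.
Proof.
apply/rowP => i; rewrite !mxE !exprMn mulrACA -exprD subnK // -ltnS; exact: ltn_ord.
Qed.

Lemma conic_vecZ E c s t : conic_vec E (c * s) (c * t) = c ^+ 2 *: conic_vec E s t.
Proof. by rewrite /conic_vec veroneseZ scalemxAl. Qed.

Lemma veronese_eq0 s t : (veronese s t == 0) = (s == 0) && (t == 0).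
Proof.
apply/eqP/andP => [v0 | [/eqP -> /eqP ->]].
  have := congr1 (fun v : 'rV_3 => v 0 0) v0; rewrite !mxE /= mulr1 => /eqP.
  rewrite sqrf_eq0 => s0.
  have := congr1 (fun v : 'rV_3 => v 0 2) v0; rewrite !mxE /= mul1r => /eqP.
  by rewrite sqrf_eq0 => t0.
by apply/rowP => i; rewrite !mxE -exprD subnK ?expr0n // -ltnS; exact: ltn_ord.
Qed.

Lemma conic_vec_eq0 E s t : row_free E ->
  (conic_vec E s t == 0) = (s == 0) && (t == 0).
Proof. by move=> Efree; rewrite mulmx_free_eq0 // veronese_eq0. Qed.

Lemma conic_vec_proportional E s t s' t' c : row_free E -> c != 0 ->
  conic_vec E s t = c *: conic_vec E s' t' -> s * t' = t * s'.
Proof.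
move=> Efree c0; rewrite /conic_vec scalemxAl => /(row_free_inj Efree)/rowP vE.
have := vE 0; have := vE 1; have := vE 2; rewrite !mxE /= !expr0 !expr1 !mulr1 !mul1r.
move=> t2 st s2; apply/eqP; rewrite -subr_eq0 -sqrf_eq0; apply/eqP.
transitivity (s ^+ 2 * t' ^+ 2 - 2 * (s * t) * (s' * t') + t ^+ 2 * s' ^+ 2); first by ring.
by rewrite s2 st t2; ring.
Qed.

(** Each equation of Y pulls back to a binary form in s and t, which either
    vanishes identically or has finitely many zeros. *)
Lemma conic_meets_closed E Y : zariski_closed Y ->
  conic E `<=` Y \/ finite_set (conic E `&` Y).
Proof.
move=> [S [Sh ->]].
have ratio s t : s != 0 -> conic_vec E s t = s ^+ 2 *: conic_vec E 1 (t / s).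
  by move=> s0; rewrite -conic_vecZ mulr1 mulrCA divff ?mulr1.
have [Sv|] := pselect (forall f, S f -> forall t, f.@[conic_vec E 1 t ord0] = 0).
  left=> p [s [t [st0 pst]]] f Sf; have [d fd] := Sh _ Sf.
  rewrite (vanishes_homog fd pst st0).
  have fZ s' t' : s' != 0 -> f.@[conic_vec E s' t' ord0] = 0.
    move=> s'0; rewrite ratio // (meval_eq (v2 := fun i => s' ^+ 2 * conic_vec E 1 (t' / s') ord0 i)).
      by rewrite (meval_homog _ _ fd) Sv ?mulr0.
    by move=> i; rewrite mxE.
  have [s0|] := eqVneq s 0; last exact: fZ.
  (* The equation is a polynomial in s, with zeros at all s != 0. *)
  have [P PE] := meval_along f
    (fun i => 'X ^+ 2 * (E 0 i)%:P + 'X * (t * E 1 i)%:P + (t ^+ 2 * E 2 i)%:P).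
  have {}PE s' : P.[s'] = f.@[conic_vec E s' t ord0].
    by rewrite PE; apply: meval_eq => i; rewrite conic_vecE !mxE !(hornerD, hornerM, horner_exp, hornerX, hornerC); ring.
  suff P0 : P = 0 by rewrite -PE P0 horner0.
  by apply: (@poly_eq0_cofinite _ _ [:: 0]) => s'; rewrite inE PE; exact: fZ.
move=> /existsNP[f /not_implyP[Sf /existsNP[t0 ft0]]]; right.
have [P PE] := meval_along f
  (fun i => 'X ^+ 2 * (E 2 i)%:P + 'X * (E 1 i)%:P + (E 0 i)%:P).
have {}PE t : P.[t] = f.@[conic_vec E 1 t ord0].
  by rewrite PE; apply: meval_eq => i; rewrite conic_vecE !mxE !(hornerD, hornerM, horner_exp, hornerX, hornerC); ring.
have /roots_seq[r Pr] : P != 0.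
  by apply: contra_notN ft0 => /eqP P0; rewrite -PE P0 horner0.
have [d fd] := Sh _ Sf.
pose V := conic_vec E 0 1 :: [seq conic_vec E 1 t | t <- r].
apply: sub_finite_set (finite_points_through V) => p [[s [t [st0 pst]]] Yp].
have [s0|s0] := eqVneq s 0.
  exists (conic_vec E 0 1); first exact: mem_head.
  have stE : conic_vec E s t = t ^+ 2 *: conic_vec E 0 1.
    by rewrite s0 -conic_vecZ mulr0 mulr1.
  move: st0 pst; rewrite stE.
  by rewrite scaler_eq0 negb_or => /andP[t20 v0]; rewrite rpredZeq (negPf t20).
move: st0 pst; rewrite ratio // scaler_eq0 negb_or => /andP[s20 v0] pst.
have {}pst : conic_vec E 1 (t / s) \in val p by move: pst; rewrite rpredZeq (negPf s20).
exists (conic_vec E 1 (t / s)) => //.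
rewrite inE map_f ?orbT //; apply: Pr; rewrite rootE PE.
by rewrite (Yp _ Sf _ pst).
Qed.

Lemma conic_infinite E : row_free E -> infinite_set (conic E).
Proof.
move=> Efree.
have v0 t : conic_vec E 1 t != 0 by rewrite conic_vec_eq0 // oner_eq0.
apply: (@sub_infinite_set _ (range (fun t => mkpoint (v0 t)))).
  by move=> _ [t _ <-]; exists 1, t; rewrite memv_line.
apply: infinite_range (@infinite_field K) => t t' _ _ /(congr1 val) /= eqt.
have := memv_line (conic_vec E 1 t); rewrite eqt => /vlineP[c cE].
have c0 : c != 0 by apply: contra_neq (v0 t) => c0; rewrite cE c0 scale0r.
by have := conic_vec_proportional Efree c0 cE; rewrite mul1r mulr1.
Qed.

Lemma conic_irreducible E : row_free E -> irreducible_set (conic E).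
Proof.
move=> Efree; split; first exact: infinite_setN0 (conic_infinite Efree).
move=> Y1 Y2 Y1cl Y2cl sub12.
have [|fin1] := conic_meets_closed E Y1cl; first by left.
have [|fin2] := conic_meets_closed E Y2cl; first by right.
case: (conic_infinite Efree).
apply: (@sub_finite_set _ _ ((conic E `&` Y1) `|` (conic E `&` Y2))).
  by move=> p Cp; case: (sub12 p Cp); [left | right].
by rewrite finite_setU.
Qed.

(** A pseudo-inverse of E computes the coordinates x0, x1, x2 of a vector of the
    plane; the equations are those of the plane together with x0 x2 = x1^2. *)
Lemma conic_closed E : row_free E -> zariski_closed (conic E).
Proof.
move=> Efree.
pose x i := linear_form (col i (pinvmx E)).
have xE i (v : 'rV_n.+1) : (x i).@[v ord0] = (v *m pinvmx E) 0 i.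
  exact: linear_form_col.
exists [set f | (exists j, f = linear_form (col j (cokermx E))) \/ f = x 0 * x 2 - x 1 ^+ 2].
split=> [f [[j ->] | ->] | ]; first by exists 1%N; exact: linear_form_homog.
  by exists 2%N; rewrite expr2 rpredB ?(dhomogM (d := 1) (e := 1)) ?linear_form_homog.
apply/seteqP; split=> p /=.
  move=> [s [t [st0 pst]]] f Sf.
  have fd : exists d, f \is d.-homog.
    case: Sf => [[j ->]|->]; first by exists 1%N; exact: linear_form_homog.
    by exists 2%N; rewrite expr2 rpredB ?(dhomogM (d := 1) (e := 1)) ?linear_form_homog.
  have [d {}fd] := fd; rewrite (vanishes_homog fd pst st0).
  case: Sf => [[j ->]|->].
    by rewrite linear_form_col /conic_vec -mulmxA mulmx_coker mulmx0 mxE.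
  rewrite mevalB rmorphXn mevalM /= !xE /conic_vec -mulmxA mulmxVp // mulmx1 !mxE /=.
  ring.
move=> fp.
have pv := coords_mem p; have v0 := coords_neq0 p; set v := coords p in pv v0.
pose y := v *m pinvmx E.
have vE : v = y *m E.
  rewrite mulmxKpV // submxE; apply/eqP/rowP => j.
  have := fp _ (or_introl (ex_intro _ j erefl)) v pv.
  by rewrite linear_form_col => ->; rewrite mxE.
have yq : y 0 0 * y 0 2 = y 0 1 ^+ 2.
  have := fp _ (or_intror erefl) v pv.
  by rewrite mevalB rmorphXn mevalM /= !xE => /eqP; rewrite subr_eq0 => /eqP.
have y0 : y != 0 by apply: contra_neq v0 => y0; rewrite vE y0 mul0mx.
clearbody y.
have [y00|y00] := eqVneq (y 0 0) 0.
  have y01 : y 0 1 = 0 by apply/eqP; rewrite -sqrf_eq0 -yq y00 mul0r.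
  exists 0, 1; have yE : y = y 0 2 *: veronese 0 1.
    apply/rowP => -[[|[|[|//]]] lt_i]; rewrite !mxE expr1n expr0n /= !(mulr0, mulr1).
    - by rewrite -[RHS]y00; congr (y 0 _); apply: val_inj.
    - by rewrite -[RHS]y01; congr (y 0 _); apply: val_inj.
    - by congr (y 0 _); apply: val_inj.
  split; first by rewrite conic_vec_eq0 // oner_eq0 andbF.
  move: pv; rewrite vE yE -scalemxAl rpredZeq => /orP[/eqP y02|//].
  by move: y0; rewrite yE y02 scale0r eqxx.
exists (y 0 0), (y 0 1); rewrite conic_vec_eq0 // (negPf y00); split=> //.
rewrite /conic_vec (_ : veronese _ _ = y 0 0 *: y) -?scalemxAl -?vE ?rpredZ //.
apply/rowP => -[[|[|[|//]]] lt_i]; rewrite !mxE /= ?expr0 ?expr1 ?mulr1 ?mul1r.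
- by rewrite expr2; congr (_ * y 0 _); apply: val_inj.
- by congr (_ * y 0 _); apply: val_inj.
- by rewrite -yq; congr (_ * y 0 _); apply: val_inj.
Qed.

Lemma conic_sub_eq E Z : row_free E -> zariski_closed Z -> irreducible_set Z ->
  Z `<=` conic E -> Z = conic E \/ exists p, Z = [set p].
Proof.
move=> Efree Zcl Zirr ZE.
have [EZ|finZ] := conic_meets_closed E Zcl; [by left; apply/seteqP | right].
apply: irreducible_finite => //; apply: sub_finite_set finZ => q Zq.
by split=> //; exact: ZE.
Qed.

End Conics.

(** * Unions of conics *)

Section Generic.
Variables (K : numClosedFieldType) (n : nat).
Implicit Types (p h : point K n) (v : 'rV[K]_n.+1) (f : {mpoly K[n.+1]}).

(** On the line from a nonzero of one polynomial to a common nonzero of the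
    others, their restrictions are nonzero polynomials in one variable, and so
    is their product. *)
Lemma exists_common_nonzero (s : seq {mpoly K[n.+1]}) :
  (forall f, f \in s -> exists v, f.@[v ord0] != 0) ->
  exists v, forall f, f \in s -> f.@[v ord0] != 0.
Proof.
suff prod_nz : (forall f, f \in s -> exists v, f.@[v ord0] != 0) ->
    exists v, (\prod_(f <- s) f).@[v ord0] != 0.
  move=> /prod_nz[v]; rewrite rmorph_prod /= => v0; exists v => f fs.
  by apply: contraNneq v0 => fv; rewrite (big_rem _ fs) /= fv mul0r.
elim: s => [|f s IHs] s_nz; first by exists 0; rewrite big_nil meval1 oner_eq0.
have [v0 fv0] := s_nz f (mem_head _ _).
have [|v1 gv1] := IHs; first by move=> g gs; apply: s_nz; rewrite inE gs orbT.
rewrite big_cons; set g := \prod_(_ <- s) _ in gv1 *.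
pose along t := v0 + t *: (v1 - v0).
have alongE t i : along t 0 i = ((v0 0 i)%:P + 'X * (v1 0 i - v0 0 i)%:P).[t].
  by rewrite !mxE !(hornerD, hornerM, hornerX, hornerC).
have [P PE] := meval_along f (fun i => (v0 0 i)%:P + 'X * (v1 0 i - v0 0 i)%:P).
have [P' P'E] := meval_along g (fun i => (v0 0 i)%:P + 'X * (v1 0 i - v0 0 i)%:P).
have {}PE t : f.@[along t ord0] = P.[t] by rewrite PE; exact: meval_eq (alongE t).
have {}P'E t : g.@[along t ord0] = P'.[t] by rewrite P'E; exact: meval_eq (alongE t).
have P0 : P != 0.
  apply: contraNneq fv0 => P0; have := PE 0.
  by rewrite P0 horner0 /along scale0r addr0 => ->.
have P'0 : P' != 0.
  apply: contraNneq gv1 => P'0; have := P'E 1.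
  by rewrite P'0 horner0 /along scale1r addrC subrK => ->.
have /roots_seq[r Pr] : P * P' != 0 by rewrite mulf_neq0.
have [t tr] := exists_notin r; exists (along t).
apply: contraNneq tr => fgt; apply: Pr.
by rewrite rootE hornerM -PE -P'E -mevalM fgt.
Qed.

(** Any finite number of conditions, each satisfied somewhere, define a notion
    of general point. *)
Lemma generic_point (s : seq {mpoly K[n.+1]}) :
  (forall f, f \in s -> (exists d, f \is d.-homog) /\ exists v, f.@[v ord0] != 0) ->
  exists2 B : set (point K n), zariski_closed B /\ B <> setT &
    forall h, ~ B h -> forall f, f \in s -> f.@[coords h ord0] != 0.
Proof.
move=> s_nz; exists [set h | exists2 f, f \in s & vanishes f h]; last first.
  move=> h Bh f fs; have [[d fd] _] := s_nz f fs.
  apply/negP => /eqP fh; apply: Bh; exists f => //.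
  exact/(vanishes_homog fd (coords_mem h) (coords_neq0 h)).
split.
  elim: s s_nz => [|f s IHs] s_nz.
    rewrite (_ : mkset _ = set0); first exact: zariski_closed0.
    by apply/seteqP; split=> // h [].
  rewrite (_ : mkset _ = [set h | vanishes f h] `|`
                         [set h | exists2 f, f \in s & vanishes f h]).
    apply: zariski_closedU.
      exists [set f]; split=> [_ -> | ]; first by have [] := s_nz f (mem_head _ _).
      by apply/seteqP; split=> h; [move=> ? _ -> | exact].
    by apply: IHs => g gs; apply: s_nz; rewrite inE gs orbT.
  apply/seteqP; split=> h.
    by move=> [g]; rewrite inE => /orP[/eqP ->|gs] gh; [left | right; exists g].
  by move=> [fh | [g gs gh]]; [exists f | exists g]; rewrite ?inE ?eqxx ?gs ?orbT.
(* Adjoining a coordinate forces the common nonzero to be a nonzero vector. *)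
have [|v v_nz] := @exists_common_nonzero ('X_0 :: s).
  move=> f; rewrite inE => /orP[/eqP -> | /s_nz[]//].
  by exists (const_mx 1); rewrite mevalXU mxE oner_eq0.
have v0 : v != 0.
  apply: contraTneq (v_nz _ (mem_head _ _)) => ->.
  by rewrite mevalXU mxE eqxx.
move=> BT; have : [set: point K n] (mkpoint v0) by [].
rewrite -BT => -[f fs fv].
have := v_nz f; rewrite inE fs orbT => /(_ isT)/eqP; apply.
by apply: fv; rewrite memv_line.
Qed.

End Generic.

Section ConicUnion.
Variables (K : numClosedFieldType) (n m : nat) (E : 'I_m -> 'M[K]_(3, n.+1)).
Hypothesis Efree : forall i, row_free (E i).
Implicit Types (p h : point K n) (Z G : set (point K n)).

Let U : set (point K n) := \bigcup_i conic (E i).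

Lemma irreducible_sub_bigcup k (C : 'I_k -> set (point K n)) Z :
  (forall i, zariski_closed (C i)) -> irreducible_set Z ->
  Z `<=` \bigcup_i C i -> exists i, Z `<=` C i.
Proof.
move=> Ccl [[p Zp] Zirr].
suff IH (s : seq 'I_k) : Z `<=` \big[setU/set0]_(i <- s) C i -> exists i, Z `<=` C i.
  move=> ZU; apply: (IH (index_enum _)) => q /ZU[i _ Ciq].
  by rewrite -bigcup_seq; exists i => //=; exact: mem_index_enum.
elim: s => [|i s IHs]; first by rewrite big_nil => /(_ p Zp).
rewrite big_cons => ZU; have [|Zi|/IHs//] := Zirr _ _ (Ccl i) _ ZU; last by exists i.
by elim/big_ind: _ => //; [exact: zariski_closed0 | exact: zariski_closedU].
Qed.

(** By [conic_sub_eq] the irreducible closed sets strictly inside the conic are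
    points, which bounds the length of chains. *)
Lemma conic_dim1 i : has_dim (conic (E i)) 1.
Proof.
have Einf := conic_infinite (Efree i); have [p Ep] := infinite_setN0 Einf.
split.
  exists (fun j => if j is 0 then [set p] else conic (E i)); split=> [[|j] _|[|//] _].
  - split; last by move=> _ ->.
    by split; [exact: zariski_closed1 | exact: irreducible1].
  - by split=> //; split; [exact: conic_closed | exact: conic_irreducible].
  - split; first by move=> _ ->.
    by move=> sub; apply: Einf; apply: sub_finite_set sub (finite_set1 p).
move=> [Z [Zirr Zlt]].
have [[Z1cl Z1irr] Z1E] := Zirr 1%N isT.
have [_ Z2E] := Zirr 2%N isT.
have [Z1 | [q Z1]] := conic_sub_eq (Efree i) Z1cl Z1irr Z1E.
  by have [_] := Zlt 1%N isT; apply; rewrite Z1.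
have [[_ [[q' Z0q'] _]] _] := Zirr 0%N isT.
have [Z01 not10] := Zlt 0%N isT; apply: not10; rewrite Z1 => _ ->.
by have := Z01 _ Z0q'; rewrite Z1 => <-.
Qed.

(** An irreducible closed subset of a finite union of closed sets lies in one of
    them, so the components are conics. *)
Lemma conic_union_curve : (0 < m)%N -> is_curve U.
Proof.
move=> m_gt0; have Ecl i := conic_closed (Efree i).
split; first exact: zariski_closed_bigcup.
  have [p Ep] := infinite_setN0 (conic_infinite (Efree (Ordinal m_gt0))).
  by exists p, (Ordinal m_gt0).
move=> Z [[Zcl Zirr] ZU Zmax].
have [i ZE] := irreducible_sub_bigcup Ecl Zirr ZU.
rewrite -(Zmax (conic (E i))) //; first exact: conic_dim1.
  by split=> //; exact: conic_irreducible.
by move=> p Ep; exists i.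
Qed.

(** A closed set that contains all but finitely many points of a conic contains
    the conic. *)
Lemma zariski_closure_conics G : G `<=` U ->
  (forall i, finite_set (conic (E i) `\` G)) -> zariski_closure G = U.
Proof.
move=> GU finG; apply/seteqP; split.
  apply: smallest_sub => //; apply: zariski_closed_bigcup => i; exact: conic_closed.
move=> p [i _ Ep] Y [Ycl GY].
have [|finY] := conic_meets_closed (E i) Ycl; first exact.
case: (conic_infinite (Efree i)).
apply: (@sub_finite_set _ _ ((conic (E i) `\` G) `|` (conic (E i) `&` Y))).
  by move=> q Eq; have [/GY|] := pselect (G q); [right | left].
by rewrite finite_setU.
Qed.

End ConicUnion.

(** * The degree of a union of conics *)

Section ConicDegree.
Variables (K : numClosedFieldType) (n : nat).
Implicit Types (p h : point K n) (v : 'rV[K]_n.+1).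

Lemma dotE (u v : 'rV[K]_n.+1) : (u *m v^T) 0 0 = \sum_i u ord0 i * v ord0 i.
Proof. by rewrite mxE; apply: eq_bigr => i _; rewrite mxE. Qed.

Lemma dotZ c (u v : 'rV[K]_n.+1) : (u *m (c *: v)^T) 0 0 = c * (u *m v^T) 0 0.
Proof. by rewrite !linearZ mxE. Qed.

Lemma dot_conic_vec (u : 'rV[K]_n.+1) (F : 'M[K]_(3, n.+1)) s t :
  (u *m (conic_vec F s t)^T) 0 0 = s ^+ 2 * (u *m (row 0 F)^T) 0 0 +
    s * t * (u *m (row 1 F)^T) 0 0 + t ^+ 2 * (u *m (row 2 F)^T) 0 0.
Proof.
rewrite conic_vecE !linearD !linearZ /=.
by move: (u *m _) (u *m _) (u *m _) => x y z; rewrite !mxE.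
Qed.

Lemma hyperplaneP p h v : v \in val p -> v != 0 ->
  hyperplane h p <-> (coords h *m v^T) 0 0 = 0.
Proof.
move=> pv v0; rewrite dotE; split=> [/(_ v pv) //|hv w].
rewrite (val_point pv v0) => /vlineP[c ->].
by under eq_bigr do rewrite mxE mulrCA; rewrite -mulr_sumr hv mulr0.
Qed.

Lemma quadratic_two_roots (A B C : K) : A != 0 -> B ^+ 2 - 4 * A * C != 0 ->
  exists2 r : bool -> K, injective r &
    forall t, A * t ^+ 2 + B * t + C = 0 <-> exists b, t = r b.
Proof.
move=> A0 D0; pose s := sqrtC (B ^+ 2 - 4 * A * C).
have s2 : s ^+ 2 = B ^+ 2 - 4 * A * C by rewrite sqrtCK.
have s0 : s != 0 by rewrite sqrtC_eq0.
have two0 : (2 : K) != 0 by rewrite pnatr_eq0.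
exists (fun b : bool => (- B + (if b then s else - s)) / (2 * A)).
  move=> b b' /(mulIf (invr_neq0 (mulf_neq0 two0 A0)))/addrI.
  have sN : s != - s by rewrite -subr_eq0 opprK -mulr2n -mulr_natl mulf_neq0.
  by case: b b' => -[] // /eqP; rewrite ?(negPf sN) // eq_sym (negPf sN).
have A20 : 2 * A != 0 by rewrite mulf_neq0.
move=> t; have tE : 4 * A * (A * t ^+ 2 + B * t + C) = (2 * A * t + B) ^+ 2 - s ^+ 2.
  by rewrite s2; ring.
have rootE u : t = (- B + u) / (2 * A) <-> 2 * A * t + B = u.
  split=> [->|<-]; first by rewrite mulrC divfK // addrC addNKr.
  by rewrite (addrC (- B)) addrK mulrAC divff // mul1r.
split=> [t0|[b /rootE tb]]; last first.
  apply: (mulfI (_ : 4 * A != 0)); first by rewrite mulf_neq0 // pnatr_eq0.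
  by rewrite tE tb mulr0; case: b {tb}; rewrite ?sqrrN subrr.
move: tE; rewrite t0 mulr0 => /esym/eqP; rewrite subr_eq0 eqf_sqr.
by case/orP => /eqP/rootE; [exists true | exists false].
Qed.

Variables (m : nat) (E : 'I_m -> 'M[K]_(3, n.+1)).
Hypotheses (Efree : forall i, row_free (E i)) (Einj : injective (fun i => conic (E i))).

(** If one conic were contained in the other, then, being closed, irreducible
    and infinite, it would be equal to it. *)
Lemma conics_meet_finite i j : i != j -> finite_set (conic (E i) `&` conic (E j)).
Proof.
move=> ij; have Ecl k := conic_closed (Efree k).
have [EiEj|//] := conic_meets_closed (E i) (Ecl j).
have [/Einj eij|[p Ep]] := conic_sub_eq (Efree j) (Ecl i) (conic_irreducible (Efree i)) EiEj.
  by rewrite eij eqxx in ij.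
by case: (conic_infinite (Efree i)); rewrite Ep.
Qed.

(** A hyperplane h meets the conic of e0, e1, e2 in the zeros of the binary form
    h(e0) s^2 + h(e1) s t + h(e2) t^2.  For a general h its discriminant is
    nonzero, and h contains none of the finitely many points common to two of
    the conics, so each conic contributes two points of its own. *)
Lemma conic_union_degree : curve_degree (\bigcup_i conic (E i)) (m * 2).
Proof.
have /fin_all_exists[I IE] : forall ij : 'I_m * 'I_m, exists s : seq (point K n),
    ij.1 != ij.2 -> conic (E ij.1) `&` conic (E ij.2) `<=` [set` s].
  move=> ij; have [|/conics_meet_finite/finite_seqP[s sE]] := eqVneq ij.1 ij.2; first by exists [::].
  by exists s => _; rewrite sE.
pose lin v := linear_form v^T.
have linE v (u : 'rV_n.+1) : (lin v).@[u ord0] = (u *m v^T) 0 0 by exact: linear_formE.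
have lin1 v : lin v \is 1.-homog by exact: linear_form_homog.
have lin_nz v : v != 0 -> exists u : 'rV_n.+1, (lin v).@[u ord0] != 0.
  move=> /rV0Pn[j vj]; exists (delta_mx 0 j).
  by rewrite linE -rowE !mxE.
pose disc i := lin (row 1 (E i)) ^+ 2 - 4 *: (lin (row 2 (E i)) * lin (row 0 (E i))).
(* Asking that h(e2) be nonzero puts the points of intersection in the chart s =
   1. *)
pose s := [seq disc i | i : 'I_m] ++ [seq lin (row 2 (E i)) | i : 'I_m] ++
  [seq lin (coords p) | p <- flatten [seq I ij | ij : 'I_m * 'I_m]].
have [f|B BT hB] := @generic_point K n s.
  rewrite !mem_cat => /or3P[/mapP[i _ ->]|/mapP[i _ ->]|/mapP[p _ ->]].
  - split; first by exists 2%N; rewrite /disc expr2 rpredB ?rpredZ ?(dhomogM (d := 1) (e := 1)) ?lin1.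
    (* A hyperplane h with h(e1) = 1 and h(e0) = h(e2) = 0, so that the
       discriminant is 1. *)
    exists (delta_mx 0 1 *m (pinvmx (E i))^T).
    have uE j : delta_mx 0 1 *m (pinvmx (E i))^T *m (row j (E i))^T = (j == 1)%:R%:M.
      rewrite -mulmxA -trmx_mul rowE -mulmxA mulmxVp // mulmx1 trmx_delta mul_delta_mx_cond.
      by rewrite eq_sym; case: eqP => _; apply/rowP => k; rewrite !ord1 !mxE !eqxx.
    rewrite /disc mevalB mevalZ expr2 !mevalM /= !linE !uE !mxE /=.
    by rewrite !mulr0n !mulr1n mul1r !mulr0 subr0 oner_eq0.
  - split; first by exists 1%N.
    by apply: lin_nz; rewrite rowE mulmx_free_eq0 //; apply/rV0Pn; exists 2; rewrite mxE eqxx oner_eq0.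
  - split; first by exists 1%N.
    by apply: lin_nz; exact: coords_neq0.
exists B => // h /hB {}hB.
have hconic i t : (coords h *m (conic_vec (E i) 1 t)^T) 0 0 =
   (lin (row 2 (E i))).@[coords h ord0] * t ^+ 2 + (lin (row 1 (E i))).@[coords h ord0] * t +
   (lin (row 0 (E i))).@[coords h ord0].
  by rewrite dot_conic_vec !linE; ring.
have h2 i : (lin (row 2 (E i))).@[coords h ord0] != 0.
  apply: hB; rewrite !mem_cat; apply/orP; right; apply/orP; left.
  by apply: (map_f (fun i => lin (row 2 (E i)))); rewrite mem_enum.
have /fin_all_exists2[r rinj rE] : forall i : 'I_m, exists2 r : bool -> K, injective r &
    forall t, (coords h *m (conic_vec (E i) 1 t)^T) 0 0 = 0 <-> exists b, t = r b.
  move=> i; have [||r rinj rE] := @quadratic_two_roots (lin (row 2 (E i))).@[coords h ord0]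
      (lin (row 1 (E i))).@[coords h ord0] (lin (row 0 (E i))).@[coords h ord0].
  - exact: h2.
  - have : disc i \in s.
      by rewrite !mem_cat; apply/orP; left; apply: (map_f disc); rewrite mem_enum.
    by move=> /hB; rewrite /disc mevalB mevalZ expr2 !mevalM /= -expr2 mulrA.
  - by exists r => // t; rewrite hconic.
have v0 i b : conic_vec (E i) 1 (r i b) != 0 by rewrite conic_vec_eq0 // oner_eq0.
pose P (ib : 'I_m * bool) := mkpoint (v0 ib.1 ib.2).
have PE ib : conic (E ib.1) (P ib) by exists 1, (r ib.1 ib.2); rewrite memv_line.
have hP ib : hyperplane h (P ib).
  by apply/(@hyperplaneP (P ib) h _ (memv_line _) (v0 _ _))/rE; exists ib.2.
have Pinj : injective P.
  move=> [i b] [j b'] eqP'.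
  have [ij|ij] := eqVneq i j.
    rewrite -ij in eqP' *; congr (_, _); apply: (rinj i).
    have := memv_line (conic_vec (E i) 1 (r i b)).
    have := congr1 val eqP'; rewrite /= => -> /vlineP[c cE].
    have c0 : c != 0 by apply: contra_neq (v0 i b) => c0; rewrite cE c0 scale0r.
    by have := conic_vec_proportional (Efree i) c0 cE; rewrite mul1r mulr1.
  have PI : P (i, b) \in I (i, j).
    by apply: (IE (i, j) ij); split; [exact: (PE (i, b)) | rewrite eqP'; exact: (PE (j, b'))].
  have : (lin (coords (P (i, b)))).@[coords h ord0] != 0.
    apply: hB; rewrite !mem_cat; apply/orP; right; apply/orP; right.
    by apply: map_f; apply/flattenP; exists (I (i, j)) => //; apply: map_f; rewrite mem_enum.
  rewrite linE => /eqP[].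
  exact/(hyperplaneP h (coords_mem _) (coords_neq0 _)).
have -> : (\bigcup_i conic (E i)) `&` hyperplane h = range P.
  apply/seteqP; split=> p; last by move=> [ib _ <-]; split; [exists ib.1 | exact: hP].
  move=> [[i _ [a [t [at0 pat]]]] hp].
  have /(hyperplaneP h pat at0) hat := hp.
  have a0 : a != 0.
    apply: contra_neq (h2 i) => a0; move: hat; rewrite dot_conic_vec a0 expr0n !mul0r !add0r.
    rewrite -linE => /eqP; rewrite mulf_eq0 sqrf_eq0 => /orP[/eqP t0|/eqP //].
    by move: at0; rewrite conic_vec_eq0 // a0 t0 eqxx.
  have vE : conic_vec (E i) a t = a ^+ 2 *: conic_vec (E i) 1 (t / a).
    by rewrite -conic_vecZ mulr1 mulrCA divff ?mulr1.
  have /rE[b tE] : (coords h *m (conic_vec (E i) 1 (t / a))^T) 0 0 = 0.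
    move: hat; rewrite vE dotZ => /eqP.
    by rewrite mulf_eq0 sqrf_eq0 (negPf a0) => /eqP.
  exists (i, b) => //; apply: (@point_eq _ _ _ _ (conic_vec (E i) 1 (r i b))) => //.
    exact: memv_line.
  by move: pat; rewrite vE tE rpredZeq sqrf_eq0 (negPf a0).
pose k := #|{: 'I_m * bool}|.
have <- : k = (m * 2)%N by rewrite /k card_prod card_ord card_bool.
have -> : range P = range (fun i : 'I_k => P (enum_val i)).
  apply/seteqP; split=> p [x _ <-]; last by exists (enum_val x).
  by exists (enum_rank x) => //; rewrite enum_rankK.
apply: card_eq_trans (inj_card_eq _) _; last by rewrite card_eq_sym; exact: card_II.
by move=> x y _ _ /Pinj/enum_val_inj.
Qed.

End ConicDegree.

Section PlaneConic.
Variables (K : numClosedFieldType) (n : nat) (E : 'M[K]_(3, n.+1)).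

Lemma conic_plane : row_free E -> plane_conic (conic E).
Proof.
move=> Efree; pose E1 (i : 'I_1) := E.
have E1U : conic E = \bigcup_i conic (E1 i).
  by apply/seteqP; split=> p; [exists 0 | case].
split; last 1 first.
- exists (limg (linfun (mulmxr E))).
    rewrite limg_dim_eq ?dimvf ?/dim /= ?muln1 //; apply/vspaceP => x.
    rewrite capfv memv0 memv_ker lfunE /=; apply/eqP/eqP => [|->]; last by rewrite mul0mx.
    by rewrite -[in RHS](mul0mx _ E) => /(row_free_inj Efree).
  move=> p [s [t [st0 pst]]]; rewrite (val_point pst st0) -memvE.
  rewrite (_ : conic_vec E s t = linfun (mulmxr E) (veronese s t)) ?memv_img ?memvf //.
  by rewrite lfunE.
- by rewrite E1U; exact: conic_union_curve.
- exact: conic_irreducible.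
rewrite E1U; apply: (@conic_union_degree _ _ 1 E1) => // i j _.
by rewrite !ord1.
Qed.

End PlaneConic.

(** * Decompositions of a biquadratic form *)

(** The pairs i < j of [idx2] enumerate the pairs of branch points. *)
Lemma idx2_lt (I : 'I_6) : ((idx2 I).1 < (idx2 I).2)%N.
Proof. by case: I => -[|[|[|[|[|[|//]]]]]]. Qed.

Lemma idx2_inj : injective idx2.
Proof.
by move=> I J /eqP; rewrite /idx2 nth_uniq // => /eqP/val_inj.
Qed.

Lemma idx2_surj (i j : 'I_4) : (i < j)%N -> exists I, idx2 I = (i, j).
Proof.
move=> ij; have ijP : (i, j) \in pairs.
  by case: i j ij => -[|[|[|[|//]]]] ? [[|[|[|[|//]]]]].
have lt6 : (index (i, j) pairs < 6)%N by rewrite index_mem.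
by exists (Ordinal lt6); rewrite /idx2 nth_index.
Qed.

Section QuadraticPencil.
Variable K : numClosedFieldType.
Implicit Types (p q al L M : {poly K}).

Lemma two_neq0 : (2 : K) != 0.
Proof. by rewrite pnatr_eq0. Qed.

Lemma size_le1_two_points p q a b : a != b -> (size p <= 2)%N -> (size q <= 2)%N ->
  p.[a] = q.[a] -> p.[b] = q.[b] -> p = q.
Proof.
move=> ab sp sq pa pb; apply/eqP; rewrite -subr_eq0; apply/negPn/negP => pq0.
have /= := max_poly_roots (rs := [:: a; b]) pq0; rewrite !rootE !hornerE pa pb !subrr eqxx.
rewrite inE ab => /(_ isT isT); apply/negP; rewrite -leqNgt.
by rewrite (leq_trans (size_polyD _ _)) // size_polyN geq_max sp.
Qed.

Lemma size_le2_two_roots p a b : a != b -> (size p <= 3)%N -> p.[a] = 0 -> p.[b] = 0 ->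
  exists c, p = c *: (('X - a%:P) * ('X - b%:P)).
Proof.
move=> ab sp pa pb; have /factor_theorem[q qE] : root p a by rewrite rootE pa.
have /factor_theorem[q' q'E] : root q b.
  move: pb; rewrite qE hornerM hornerXsubC => /eqP.
  by rewrite mulf_eq0 subr_eq0 [b == a]eq_sym (negPf ab) orbF.
have sq' : (size q' <= 1)%N.
  have [->|q'0] := eqVneq q' 0; first by rewrite size_poly0.
  have := sp; rewrite qE q'E !size_Mmonic ?monicXsubC ?mulf_neq0 ?polyXsubC_eq0 //.
  by rewrite !size_XsubC !addn2.
exists q'`_0; rewrite qE q'E {1}(size1_polyC sq') -mul_polyC -mulrA.
by rewrite [('X - b%:P) * _]mulrC.
Qed.

(** The products l^2, l m, m^2 are the coefficients of the square of a linear
    form, which determine the form up to sign. *)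
Lemma sign_pair (x y l m : K) : (l, m) != (0, 0) ->
  x ^+ 2 = l ^+ 2 -> x * y = l * m -> y ^+ 2 = m ^+ 2 ->
  exists e : bool, x = (-1) ^+ e * l /\ y = (-1) ^+ e * m.
Proof.
move=> lm0 /eqP + xy /eqP; rewrite !eqf_sqr => /orP[] /eqP xE.
  have [l0|l0] := eqVneq l 0.
    rewrite xE l0; case/orP => /eqP ->; [exists false | exists true].
      by rewrite !expr0 !mul1r.
    by rewrite !expr1 !mulN1r oppr0.
  move=> _; exists false; rewrite !expr0 !mul1r; split=> //.
  by apply: (mulfI l0); rewrite -xy xE.
have [l0|l0] := eqVneq l 0.
  rewrite xE l0 oppr0; case/orP => /eqP ->; [exists false | exists true].
    by rewrite !expr0 !mul1r.
  by rewrite !expr1 !mulN1r oppr0.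
move=> _; exists true; rewrite !expr1 !mulN1r; split=> //.
by apply: (mulfI l0); rewrite mulrN -xy xE mulNr opprK.
Qed.

(** The multiplicity of a is even on the left and, if p is nonzero, odd on the
    right. *)
Lemma square_times_simple p q d a : root d a -> ~~ root d^`() a ->
  q ^+ 2 = d * p ^+ 2 -> p = 0.
Proof.
move=> da d'a qE; apply/eqP/negPn/negP => p0.
have d0 : d != 0 by apply: contraNneq d'a => ->; rewrite deriv0 root0.
have q0 : q != 0 by rewrite -sqrf_eq0 qE mulf_neq0 ?sqrf_eq0.
have mud : mup a d = 1%N.
  apply/eqP; rewrite eqn_leq -(XsubC_dvd _ d0) dvdp_XsubCl da andbT mup_leq //.
  apply: contra d'a => /dvdpP[c ->].
  by rewrite rootE expr2 !derivM derivXsubC !(hornerD, hornerM, hornerX, hornerN, hornerC) subrr !(mulr0, mul0r, addr0).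
have := congr1 (fun p => odd (mup a p)) qE.
by rewrite !expr2 !mupM ?mulf_neq0 // mud !oddD !addbb.
Qed.

(** The polynomials f0, f1, f2 in the coordinate t of the first line are the
    coefficients of a form f0 y^2 + f1 y z + f2 z^2.  A solution writes lam
    times this form as al ga - (L y + M z)^2, where al is a quadratic form on
    the first line, dehomogenized, and ga = g0 y^2 + g1 y z + g2 z^2 a quadratic
    form on the second line. *)
Definition pencil_solution (f0 f1 f2 : {poly K}) lam al L M (g0 g1 g2 : K) : Prop :=
  [/\ (size al <= 3)%N, (size L <= 2)%N, (size M <= 2)%N &
   [/\ g0 *: al - L ^+ 2 = lam *: f0, g1 *: al - 2 *: (L * M) = lam *: f1 &
      g2 *: al - M ^+ 2 = lam *: f2]].

Lemma interpolation a b (u v : K) : a != b ->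
  exists p, [/\ (size p <= 2)%N, p.[a] = u & p.[b] = v].
Proof.
move=> ab; exists (((u - v) / (a - b)) *: ('X - a%:P) + u%:P).
have ab0 : a - b != 0 by rewrite subr_eq0.
split; last 2 first.
- by rewrite hornerD hornerZ hornerXsubC hornerC subrr mulr0 add0r.
- by rewrite hornerD hornerZ hornerXsubC hornerC; field.
rewrite (leq_trans (size_polyD _ _)) // geq_max (leq_trans (size_polyC_leq1 _)) // andbT.
by rewrite (leq_trans (size_scale_leq _ _)) // size_XsubC.
Qed.

Lemma size_square_le3 p q : (size p <= 2)%N -> (size q <= 2)%N -> (size (p * q)%R <= 3)%N.
Proof.
move=> sp sq; apply: leq_trans (size_polyMleq _ _) _.
by rewrite -subn1 leq_subLR (leq_add sp sq).
Qed.

Variables f0 f1 f2 : {poly K}.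
(** The roots of D are the branch points, above which the two zeros of the form
    come together.  The hypotheses say that there are four of them, all in the
    chart. *)
Let D := f1 ^+ 2 - 4 *: (f0 * f2).
Hypotheses (sf0 : (size f0 <= 3)%N) (sf1 : (size f1 <= 3)%N) (sf2 : (size f2 <= 3)%N).
Hypothesis sD : size D = 5%N.
Hypothesis f_coprime : forall t, ~~ [&& root f0 t, root f1 t & root f2 t].
Hypothesis D_simple : forall t, root D t -> ~~ root D^`() t.

Lemma discriminant_roots : exists2 r : 'I_4 -> K, injective r &
  forall t, root D t <-> exists i, t = r i.
Proof.
have [rs DE] := closed_field_poly_normal D.
have D0 : D != 0 by rewrite -size_poly_eq0 sD.
have lD : lead_coef D != 0 by rewrite lead_coef_eq0.
have srs : size rs = 4%N.
  have := sD; rewrite DE size_scale // size_prod_XsubC => -[->//].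
have urs : uniq rs.
  rewrite -separable_prod_XsubC -(eqp_separable (eqp_scale _ lD)) -DE.
  rewrite unlock; apply/Pdiv.ClosedField.coprimepP => t Dt.
  exact: D_simple.
exists (fun i => rs`_i).
  by move=> i j /eqP; rewrite nth_uniq ?srs // => /eqP/val_inj.
move=> t; rewrite DE rootZ // root_prod_XsubC; split=> [t_rs|[i ->]]; last by rewrite mem_nth ?srs.
have lt_t : (index t rs < 4)%N by rewrite -srs index_mem.
by exists (Ordinal lt_t); rewrite nth_index.
Qed.

(** A binary quadratic form with zero discriminant is a square; lm.1 y + lm.2 z
    is a square root of minus the form above t. *)
Lemma discriminant_square_root t : root D t -> exists lm : K * K,
  [/\ lm != (0, 0), lm.1 ^+ 2 = - f0.[t], 2 * lm.1 * lm.2 = - f1.[t] & lm.2 ^+ 2 = - f2.[t]].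
Proof.
rewrite rootE !(hornerD, hornerN, hornerZ, horner_exp, hornerM) subr_eq0 => /eqP Dt.
pose l := sqrtC (- f0.[t]); pose m := sqrtC (- f2.[t]).
have l2 : l ^+ 2 = - f0.[t] by rewrite sqrtCK.
have m2 : m ^+ 2 = - f2.[t] by rewrite sqrtCK.
have : (2 * l * m) ^+ 2 == f1.[t] ^+ 2.
  by rewrite !exprMn l2 m2 Dt; apply/eqP; ring.
suff lm_nz l' m' : l' ^+ 2 = - f0.[t] -> 2 * l' * m' = - f1.[t] -> m' ^+ 2 = - f2.[t] -> (l', m') != (0, 0).
  rewrite eqf_sqr => /orP[]/eqP lm; [exists (l, - m) | exists (l, m)]; split; rewrite ?lm_nz ?sqrrN //= ?mulrN ?lm //.
move=> l'2 lm' m'2; apply: contra (f_coprime t) => /eqP[l'0 m'0].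
rewrite !rootE -!(oppr_eq0 _.[t]) -l'2 -m'2 -lm' l'0 m'0.
by rewrite !mulr0 expr0n eqxx.
Qed.

Let sqrt_at t (lm : K * K) :=
  [/\ lm.1 ^+ 2 = - f0.[t], 2 * lm.1 * lm.2 = - f1.[t] & lm.2 ^+ 2 = - f2.[t]].

(** The linear form L y + M z interpolates square roots of minus the form above
    a and above b.  Adding its square to the form gives a quadratic polynomial
    in t that vanishes at a and b. *)
Lemma solution_through a b lm lm' : a != b -> sqrt_at a lm -> sqrt_at b lm' ->
  exists L M g0 g1 g2,
    [/\ pencil_solution f0 f1 f2 1 (('X - a%:P) * ('X - b%:P)) L M g0 g1 g2,
        (L.[a], M.[a]) = lm & (L.[b], M.[b]) = lm'].
Proof.
move=> ab [l2 lm2 m2] [l'2 lm'2 m'2].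
have [L [sL La Lb]] := interpolation lm.1 lm'.1 ab.
have [M [sM Ma Mb]] := interpolation lm.2 lm'.2 ab.
have quot (f p : {poly K}) : (size f <= 3)%N -> (size p <= 3)%N -> p.[a] = - f.[a] -> p.[b] = - f.[b] ->
    exists g, g *: (('X - a%:P) * ('X - b%:P)) - p = 1 *: f.
  move=> sf sp pa pb; have [|||g gE] := @size_le2_two_roots (f + p) a b ab.
  - by rewrite (leq_trans (size_polyD _ _)) // geq_max sf.
  - by rewrite hornerD pa subrr.
  - by rewrite hornerD pb subrr.
  by exists g; rewrite -gE scale1r addrK.
have [||g0 g0E] := quot f0 (L ^+ 2) sf0 (size_square_le3 sL sL).
- by rewrite horner_exp La l2.
- by rewrite horner_exp Lb l'2.
have [|||g1 g1E] := quot f1 (2 *: (L * M)) sf1.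
- by rewrite (leq_trans (size_scale_leq _ _)) // size_square_le3.
- by rewrite hornerZ hornerM La Ma mulrA lm2.
- by rewrite hornerZ hornerM Lb Mb mulrA lm'2.
have [||g2 g2E] := quot f2 (M ^+ 2) sf2 (size_square_le3 sM sM).
- by rewrite horner_exp Ma m2.
- by rewrite horner_exp Mb m'2.
exists L, M, g0, g1, g2; rewrite La Lb Ma Mb -!surjective_pairing.
split=> //; split=> //.
by rewrite size_square_le3 ?size_XsubC.
Qed.

(** The discriminant of al ga - be^2 in y and z is divisible by al, because
    modulo al it is the discriminant of a square. *)
Lemma solution_discriminant lam al L M g0 g1 g2 :
  pencil_solution f0 f1 f2 lam al L M g0 g1 g2 ->
  lam ^+ 2 *: D = al * ((g1 ^+ 2 - 4 * g0 * g2) *: al +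
    4 *: (g0 *: M ^+ 2 - g1 *: (L * M) + g2 *: L ^+ 2)).
Proof.
move=> [_ _ _ [e0 e1 e2]].
have -> : lam ^+ 2 *: D = (lam *: f1) ^+ 2 - 4 *: ((lam *: f0) * (lam *: f2)).
  by rewrite /D -!mul_polyC !polyCM; ring.
rewrite -e0 -e1 -e2 -!mul_polyC !(polyCM, polyCB, polyC_exp).
by rewrite -[4%:R%:P]/(polyC 4) !polyC_natr; ring.
Qed.

(** The polynomial al divides the discriminant D, whose roots are simple. *)
Lemma solution_roots lam al L M g0 g1 g2 : lam != 0 ->
  pencil_solution f0 f1 f2 lam al L M g0 g1 g2 ->
  exists a b c, [/\ a != b, root D a, root D b, c != 0 &
    al = c *: (('X - a%:P) * ('X - b%:P))].
Proof.
move=> lam0 sol; have [sal sL sM _] := sol; have DE := solution_discriminant sol.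
have sD' : size (lam ^+ 2 *: D) = 5%N by rewrite size_scale ?expf_neq0.
have al0 : al != 0 by apply: contra_eq_neq sD' => al0; rewrite DE al0 mul0r size_poly0.
set q := (X in al * X) in DE.
have sq : (size q <= maxn (size al) 3)%N.
  have scale3 c p p' : (size p <= 2)%N -> (size p' <= 2)%N -> (size (c *: (p * p'))%R <= 3)%N.
    by move=> sp sp'; rewrite (leq_trans (size_scale_leq _ _)) // size_square_le3.
  have sum3 p p' : (size p <= 3)%N -> (size p' <= 3)%N -> (size (p + p')%R <= 3)%N.
    by move=> sp sp'; rewrite (leq_trans (size_polyD _ _)) // geq_max sp.
  have s3 : (size (g0 *: M ^+ 2 - g1 *: (L * M) + g2 *: L ^+ 2)%R <= 3)%N.
    by rewrite -scaleNr; apply: (sum3 _ _ (sum3 _ _ _ _)); apply: scale3.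
  rewrite (leq_trans (size_polyD _ _)) // geq_max !leq_max size_scale_leq /=.
  by rewrite (leq_trans (size_scale_leq _ _) s3) orbT.
(* Otherwise al would have a root at infinity, and D, which is divisible by al,
   would have degree less than 4. *)
have {sal} sal : size al = 3%N.
  apply/eqP; rewrite eqn_leq sal leqNgt; apply/negP => sal2.
  have := size_polyMleq al q; rewrite -DE sD' leqNgt => /negP; apply.
  rewrite (maxn_idPr (ltnW sal2)) in sq.
  by rewrite -subn1 ltnS leq_subLR (leq_add (_ : (size al <= 2)%N) sq).
have rootD t : root al t -> root D t.
  by move=> alt; rewrite -(rootZ _ _ (expf_neq0 2 lam0)) DE rootM alt.
have /closed_rootP[a ala] : size al != 1 by rewrite sal.
have /factor_theorem[p pE] := ala.
have p0 : p != 0 by apply: contra_neq al0 => p0; rewrite pE p0 mul0r.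
have sp : size p = 2.
  by have := sal; rewrite pE size_Mmonic ?monicXsubC // size_XsubC addn2 => -[].
have /closed_rootP[b pb] : size p != 1 by rewrite sp.
have /factor_theorem[c cE] := pb.
have c0 : c != 0 by apply: contra_neq p0 => c0; rewrite cE c0 mul0r.
have sc : size c = 1.
  by have := sp; rewrite cE size_Mmonic ?monicXsubC // size_XsubC addn2 => -[].
have alE : al = c`_0 *: (('X - a%:P) * ('X - b%:P)).
  rewrite pE cE {1}(size1_polyC (eq_leq sc)) -mul_polyC -mulrA.
  by rewrite [('X - b%:P) * _]mulrC.
have c00 : c`_0 != 0 by apply: contra_neq c0 => c00; rewrite (size1_polyC (eq_leq sc)) c00.
have Da := rootD _ ala.
exists a, b, c`_0; split=> //.
- have := D_simple Da; apply: contraNneq => eab; rewrite -(rootZ _ _ (expf_neq0 2 lam0)).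
  rewrite -derivZ DE alE eab -scalerAl derivZ rootZ //.
  by rewrite rootE !derivM derivXsubC !(hornerD, hornerM, hornerX, hornerN, hornerC) subrr !(mulr0, mul0r, addr0).
- by apply: rootD; rewrite pE rootM pb.
Qed.

(** Where al vanishes, the equations only involve the square of L y + M z. *)
Lemma solution_at_root lam mu al L M g0 g1 g2 a lm :
  mu != 0 -> mu ^+ 2 = lam -> root al a -> sqrt_at a lm -> lm != (0, 0) ->
  pencil_solution f0 f1 f2 lam al L M g0 g1 g2 ->
  exists e : bool, L.[a] = (-1) ^+ e * (mu * lm.1) /\ M.[a] = (-1) ^+ e * (mu * lm.2).
Proof.
move=> mu0 mu2; rewrite rootE => /eqP ala [l2 lm2 m2] lm0 [_ _ _ [e0 e1 e2]].
have at_a p q c d : c *: al - p = lam *: q -> d = - q.[a] -> p.[a] = mu ^+ 2 * d.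
  move=> /(congr1 (horner^~ a)); rewrite hornerD hornerN !hornerZ ala mulr0 add0r mu2 => pE ->.
  by rewrite mulrN -pE opprK.
apply: sign_pair.
- apply: contra lm0; case: (lm) => l m /= /eqP[/eqP + /eqP].
  by rewrite !mulf_eq0 (negPf mu0) => /eqP -> /eqP ->.
- by rewrite exprMn -horner_exp (at_a _ _ _ _ e0 l2).
- apply: (mulfI two_neq0); have := at_a _ _ _ _ e1 lm2.
  by rewrite hornerZ hornerM => ->; ring.
- by rewrite exprMn -horner_exp (at_a _ _ _ _ e2 m2).
Qed.

(** L and M are determined by their values at a and b, and then ga by the
    quotient of lam F + be^2 by al. *)
Lemma solution_determined lam c nu a b al L M g0 g1 g2 L' M' g0' g1' g2' :
  a != b -> c != 0 -> nu ^+ 2 = lam -> al = ('X - a%:P) * ('X - b%:P) ->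
  pencil_solution f0 f1 f2 1 al L M g0 g1 g2 ->
  pencil_solution f0 f1 f2 lam (c *: al) L' M' g0' g1' g2' ->
  L'.[a] = nu * L.[a] -> M'.[a] = nu * M.[a] ->
  L'.[b] = nu * L.[b] -> M'.[b] = nu * M.[b] ->
  [/\ L' = nu *: L, M' = nu *: M &
      [/\ g0' = nu ^+ 2 / c * g0, g1' = nu ^+ 2 / c * g1 & g2' = nu ^+ 2 / c * g2]].
Proof.
move=> ab c0 nu2 alE [_ sL sM [e0 e1 e2]] [_ sL' sM' [e0' e1' e2']] La Ma Lb Mb.
have LE : L' = nu *: L.
  apply: (size_le1_two_points ab); rewrite ?hornerZ //.
  by rewrite (leq_trans (size_scale_leq _ _)).
have ME : M' = nu *: M.
  apply: (size_le1_two_points ab); rewrite ?hornerZ //.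
  by rewrite (leq_trans (size_scale_leq _ _)).
have al0 : al != 0 by rewrite alE mulf_neq0 ?polyXsubC_eq0.
have gE (p q f : {poly K}) g g' : p = nu ^+ 2 *: q ->
    g *: al - q = 1 *: f -> g' *: (c *: al) - p = lam *: f -> g' = nu ^+ 2 / c * g.
  move=> pE gf g'f; have : (g' * c) *: al = (nu ^+ 2 * g) *: al.
    rewrite -scalerA -(subrK p (g' *: _)) g'f pE -nu2 -[f]scale1r -gf.
    by rewrite -scalerDr subrK scalerA.
  move=> /eqP; rewrite -subr_eq0 -scalerBl scaler_eq0 (negPf al0) orbF subr_eq0 => /eqP g'c.
  by rewrite mulrAC -g'c mulfK.
split=> //; split.
- by apply: gE e0 e0'; rewrite LE exprZn.
- by apply: gE e1 e1'; rewrite LE ME -scalerAl -scalerAr !scalerA; congr (_ *: _); ring.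
- by apply: gE e2 e2'; rewrite ME exprZn.
Qed.

(** A solution amounts to the choice of two of the four branch points, the roots
    of al, and of square roots of minus the form above them.  Changing both
    square roots by a common factor is absorbed by nu, so only their relative
    sign, recorded by the boolean, distinguishes the families. *)
Lemma pencil_solutions : exists (al L M : 'I_6 * bool -> {poly K}) (g0 g1 g2 : 'I_6 * bool -> K),
  [/\ forall k, pencil_solution f0 f1 f2 1 (al k) (L k) (M k) (g0 k) (g1 k) (g2 k),
      forall k, [/\ al k != 0, (L k, M k) != (0, 0) & (g0 k, g1 k, g2 k) != (0, 0, 0)],
      forall k k' x y, al k = x *: al k' -> L k = y *: L k' -> M k = y *: M k' -> k = k' &
      forall lam al' L' M' g0' g1' g2', lam != 0 ->
        pencil_solution f0 f1 f2 lam al' L' M' g0' g1' g2' ->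
        exists k c nu, [/\ c != 0, nu != 0, al' = c *: al k,
          L' = nu *: L k /\ M' = nu *: M k &
          [/\ g0' = nu ^+ 2 / c * g0 k, g1' = nu ^+ 2 / c * g1 k &
              g2' = nu ^+ 2 / c * g2 k]]].
Proof.
have [r r_inj rE] := discriminant_roots.
have Dr i : root D (r i) by apply/rE; exists i.
have /fin_all_exists[lm lmP] i := discriminant_square_root (Dr i).
have lm0 i : lm i != (0, 0) by case: (lmP i).
have lm_sqrt i : sqrt_at (r i) (lm i) by case: (lmP i).
have sg_sqrt (e : bool) i : sqrt_at (r i) ((-1) ^+ e * (lm i).1, (-1) ^+ e * (lm i).2).
  have [l2 lm2 m2] := lm_sqrt i; split; rewrite /= ?exprMn ?sqrr_sign ?mul1r //.
  by rewrite -lm2; case: e; rewrite ?expr0 ?expr1; ring.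
pose i (k : 'I_6 * bool) := (idx2 k.1).1; pose j (k : 'I_6 * bool) := (idx2 k.1).2.
have rij k : r (i k) != r (j k).
  by rewrite (inj_eq r_inj) -(inj_eq val_inj) (ltn_eqF (idx2_lt _)).
have /fin_all_exists[S SP] (k : 'I_6 * bool) : exists S : {poly K} * {poly K} * K * K * K,
    let: (L, M, g0, g1, g2) := S in
    [/\ pencil_solution f0 f1 f2 1 (('X - (r (i k))%:P) * ('X - (r (j k))%:P)) L M g0 g1 g2,
        (L.[r (i k)], M.[r (i k)]) = lm (i k) &
        (L.[r (j k)], M.[r (j k)]) = ((-1) ^+ k.2 * (lm (j k)).1, (-1) ^+ k.2 * (lm (j k)).2)].
  have [L [M [g0 [g1 [g2 LMP]]]]] := solution_through (rij k) (lm_sqrt (i k)) (sg_sqrt k.2 (j k)).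
  by exists (L, M, g0, g1, g2).
pose al k := ('X - (r (i k))%:P) * ('X - (r (j k))%:P).
pose L k := (S k).1.1.1.1; pose M k := (S k).1.1.1.2.
pose g0 k := (S k).1.1.2; pose g1 k := (S k).1.2; pose g2 k := (S k).2.
have {}SP k : [/\ pencil_solution f0 f1 f2 1 (al k) (L k) (M k) (g0 k) (g1 k) (g2 k),
        ((L k).[r (i k)], (M k).[r (i k)]) = lm (i k) &
        ((L k).[r (j k)], (M k).[r (j k)]) =
          ((-1) ^+ k.2 * (lm (j k)).1, (-1) ^+ k.2 * (lm (j k)).2)].
  by have := SP k; rewrite /L /M /g0 /g1 /g2; case: (S k) => [[[[? ?] ?] ?] ?].
have al0 k : al k != 0 by rewrite mulf_neq0 ?polyXsubC_eq0.
exists al, L, M, g0, g1, g2; split.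
- by move=> k; case: (SP k).
- move=> k; have [sol lmi _] := SP k; split=> //.
    by apply: contra (lm0 (i k)) => /eqP[L0 M0]; rewrite -lmi L0 M0 horner0.
  apply/eqP => -[g00 g10 g20]; have := solution_discriminant sol.
  rewrite g00 g10 g20 expr0n !(mulr0, scale0r, subr0, scaler0, addr0) expr1n scale1r => D0.
  by have := sD; rewrite D0 size_poly0.
- move=> k k' x y alE LE ME.
  have root_al k1 t : root (al k1) t = (t == r (i k1)) || (t == r (j k1)).
    by rewrite rootM !root_XsubC.
  have ij_sub u : root (al k) (r u) -> (u == i k') || (u == j k').
    rewrite alE -!(inj_eq r_inj) -root_al => alu.
    have x0 : x != 0 by apply: contraNneq (al0 k) => x0; rewrite alE x0 scale0r.
    by rewrite rootZ in alu.
  have ii := ij_sub (i k); rewrite root_al eqxx in ii.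
  have jj := ij_sub (j k); rewrite root_al eqxx orbT in jj.
  have ik := idx2_lt k.1; have ik' := idx2_lt k'.1.
  have [iE jE] : i k = i k' /\ j k = j k'.
    case/orP: (ii isT) => /eqP iE; case/orP: (jj isT) => /eqP jE //.
    - by move: ik; rewrite -/(i k) -/(j k) iE jE ltnn.
    - by move: ik ik'; rewrite -/(i k) -/(j k) iE jE => /ltnW; rewrite leqNgt => /negPf ->.
    - by move: ik; rewrite -/(i k) -/(j k) iE jE ltnn.
  have IE : k.1 = k'.1.
    by apply: idx2_inj; rewrite [LHS]surjective_pairing [RHS]surjective_pairing; congr (_, _).
  have [_ lmi lmj] := SP k; have [_ lmi' lmj'] := SP k'.
  have y1 : y = 1.
    move: lmi lmi'; rewrite LE ME !hornerZ -iE => lmi lmi'.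
    have := lm0 (i k); rewrite -lmi' => nz; move: lmi; rewrite -lmi' => -[].
    move: nz; rewrite xpair_eqE negb_and => /orP[] nz yE1 yE2.
      by apply: (mulIf nz); rewrite mul1r.
    by apply: (mulIf nz); rewrite mul1r.
  suff k2 : k.2 = k'.2 by rewrite [k]surjective_pairing [k']surjective_pairing IE k2.
  move: lmj lmj'; rewrite LE ME y1 !scale1r -jE => -> [] eq1 eq2.
  have sgn_eq (z : K) : z != 0 -> (-1) ^+ k.2 * z = (-1) ^+ k'.2 * z -> k.2 = k'.2.
    by move=> z0 /(mulIf z0)/signr_inj.
  move: (lm0 (j k)); rewrite (surjective_pairing (lm (j k))) xpair_eqE negb_and.
  by case/orP => z0; [exact: sgn_eq z0 eq1 | exact: sgn_eq z0 eq2].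
move=> lam al' L' M' g0' g1' g2' lam0 sol.
have [a [b [c [ab Da Db c0 al'E]]]] := solution_roots lam0 sol.
have [u aE] := (rE a).1 Da; have [v bE] := (rE b).1 Db.
have [w [w' [ww' al'E']]] : exists w w' : 'I_4, (w < w')%N /\
    al' = c *: (('X - (r w)%:P) * ('X - (r w')%:P)).
  have : u != v by apply: contraNneq ab => uv; rewrite aE bE uv.
  rewrite neq_ltn => /orP[uv|vu]; [exists u, v | exists v, u]; split=> //.
    by rewrite al'E aE bE.
  by rewrite al'E aE bE [X in _ *: X]mulrC.
have [I IE] := idx2_surj ww'.
(* A solution for lam multiplies the chosen square roots above the branch points
   by mu, up to sign. *)
pose mu := sqrtC lam; have mu2 : mu ^+ 2 = lam by rewrite sqrtCK.
have mu0 : mu != 0 by rewrite sqrtC_eq0.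
have al'w : root al' (r w) by rewrite al'E' rootZ // rootM root_XsubC eqxx.
have al'w' : root al' (r w') by rewrite al'E' rootZ // rootM !root_XsubC eqxx orbT.
have [e [Le Me]] := solution_at_root mu0 mu2 al'w (lm_sqrt w) (lm0 w) sol.
have [e' [Le' Me']] := solution_at_root mu0 mu2 al'w' (lm_sqrt w') (lm0 w') sol.
pose k := (I, e (+) e'); have [sol1 lmi lmj] := SP k.
have [ik jk] : i k = w /\ j k = w' by rewrite /i /j /= IE.
exists k, c, ((-1) ^+ e * mu); rewrite ik jk in lmi lmj.
have sg : (-1) ^+ e * (-1) ^+ (e (+) e') = (-1) ^+ e' :> K.
  by rewrite signr_addb mulrA -expr2 sqrr_sign mul1r.
have al'k : al' = c *: al k by rewrite al'E' /al ik jk.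
have [] := @solution_determined lam c ((-1) ^+ e * mu) (r w) (r w') (al k) (L k) (M k)
  (g0 k) (g1 k) (g2 k) L' M' g0' g1' g2'.
- by rewrite -ik -jk.
- exact: c0.
- by rewrite exprMn sqrr_sign mul1r.
- by rewrite /al ik jk.
- exact: sol1.
- by rewrite -al'k.
- by rewrite Le -lmi mulrA.
- by rewrite Me -lmi mulrA.
- by case: lmj => -> _; rewrite Le' -sg; ring.
- by case: lmj => _ ->; rewrite Me' -sg; ring.
by split=> //; rewrite mulf_neq0 ?signr_eq0.
Qed.

End QuadraticPencil.

(** * Smooth curves of bidegree (2,2) *)

Section CommonComponent.
Variable K : numClosedFieldType.
Implicit Types (f g : {poly K}).

Lemma binary_quadratic_zero (a b c : K) : exists y z,
  (y != 0) || (z != 0) /\ a * y ^+ 2 + b * (y * z) + c * z ^+ 2 = 0.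
Proof.
have [->|a0] := eqVneq a 0; first by exists 1, 0; rewrite oner_eq0; split=> //; ring.
have two0 : (2 : K) != 0 := two_neq0 K.
pose s := sqrtC (b ^+ 2 - 4 * a * c); have s2 : s ^+ 2 = b ^+ 2 - 4 * a * c by rewrite sqrtCK.
exists (s - b), (2 * a); rewrite mulf_neq0 ?orbT //; split=> //.
have -> : a * (s - b) ^+ 2 + b * ((s - b) * (2 * a)) + c * (2 * a) ^+ 2 =
  a * (s ^+ 2 - (b ^+ 2 - 4 * a * c)) by ring.
by rewrite s2 subrr mulr0.
Qed.

Lemma binary_quadratic_roots (a b c : K) : (a, b, c) != (0, 0, 0) ->
  exists r : seq K, forall y z, a * y ^+ 2 + b * (y * z) + c * z ^+ 2 = 0 ->
    z != 0 -> y / z \in r.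
Proof.
move=> abc0; pose p := a%:P * 'X ^+ 2 + b%:P * 'X + c%:P.
have pE t : p.[t] = a * t ^+ 2 + b * t + c.
  by rewrite !(hornerD, hornerM, horner_exp, hornerX, hornerC).
have /roots_seq[r pr] : p != 0.
  apply: contraNneq abc0 => p0.
  have p_at t : a * t ^+ 2 + b * t + c = 0 by rewrite -pE p0 horner0.
  have c0 : c = 0 by rewrite -(p_at 0); ring.
  have a0 : a = 0.
    apply: (mulfI (two_neq0 K)); rewrite mulr0.
    have -> : 2 * a = (a * 1 ^+ 2 + b * 1 + c) + (a * (-1) ^+ 2 + b * (-1) + c) - 2 * c by ring.
    by rewrite !p_at c0; ring.
  have b0 : b = 0 by rewrite -(p_at 1) a0 c0; ring.
  by rewrite a0 b0 c0.
exists r => y z yz z0; apply: pr; rewrite rootE pE; apply/eqP.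
apply: (mulIf (_ : z ^+ 2 != 0)); first by rewrite expf_neq0.
by rewrite mul0r -yz; field.
Qed.

Definition minor (f g f' g' : {poly K}) := f * g' - f' * g.

(** The resultant of two binary quadratic forms, written in the minors of their
    coefficients. *)
Definition quadratic_resultant (f0 f1 f2 g0 g1 g2 : {poly K}) :=
  minor f0 g0 f2 g2 ^+ 2 - minor f0 g0 f1 g1 * minor f1 g1 f2 g2.

(** Eliminating one of the monomials y^2, y z, z^2 at a time between the two
    equations yields linear relations between the minors. *)
Lemma resultant_common_root f0 f1 f2 g0 g1 g2 t (y z : K) : (y != 0) || (z != 0) ->
  f0.[t] * y ^+ 2 + f1.[t] * (y * z) + f2.[t] * z ^+ 2 = 0 ->
  g0.[t] * y ^+ 2 + g1.[t] * (y * z) + g2.[t] * z ^+ 2 = 0 ->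
  root (quadratic_resultant f0 f1 f2 g0 g1 g2) t.
Proof.
move=> yz0 fyz gyz; rewrite rootE /quadratic_resultant /minor.
rewrite !(hornerD, hornerN, hornerM, horner_exp).
move: fyz gyz; move: f0.[t] f1.[t] f2.[t] g0.[t] g1.[t] g2.[t] => a b c a' b' c' fyz gyz.
have e1 : z * ((a * b' - b * a') * y + (a * c' - c * a') * z) = 0.
  have -> : z * ((a * b' - b * a') * y + (a * c' - c * a') * z) =
    a * (a' * y ^+ 2 + b' * (y * z) + c' * z ^+ 2) - a' * (a * y ^+ 2 + b * (y * z) + c * z ^+ 2) by ring.
  by rewrite fyz gyz; ring.
have e2 : y * ((a * c' - c * a') * y + (b * c' - c * b') * z) = 0.
  have -> : y * ((a * c' - c * a') * y + (b * c' - c * b') * z) =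
    c' * (a * y ^+ 2 + b * (y * z) + c * z ^+ 2) - c * (a' * y ^+ 2 + b' * (y * z) + c' * z ^+ 2) by ring.
  by rewrite fyz gyz; ring.
have e3 : (a * b' - b * a') * y ^+ 2 = (b * c' - c * b') * z ^+ 2.
  apply/eqP; rewrite -subr_eq0; apply/eqP.
  have -> : (a * b' - b * a') * y ^+ 2 - (b * c' - c * b') * z ^+ 2 =
    b' * (a * y ^+ 2 + b * (y * z) + c * z ^+ 2) - b * (a' * y ^+ 2 + b' * (y * z) + c' * z ^+ 2) by ring.
  by rewrite fyz gyz; ring.
move: e1 e2 e3; move: (a * b' - b * a') (a * c' - c * a') (b * c' - c * b') => u v w e1 e2 e3.
have [z0|z0] := eqVneq z 0.
  have y0 : y != 0 by move: yz0; rewrite z0 eqxx orbF.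
  have u0 : u = 0 by apply: (mulIf (expf_neq0 2 y0)); rewrite e3 z0; ring.
  have v0 : v = 0 by apply: (mulIf (expf_neq0 2 y0)); rewrite mul0r -e2 z0; ring.
  by rewrite u0 v0; apply/eqP; ring.
have vE : v * z = - (u * y).
  by apply/eqP; rewrite -subr_eq0 opprK addrC; apply/eqP; apply: (mulfI z0); rewrite e1 mulr0.
apply/eqP; apply: (mulIf (expf_neq0 2 z0)); rewrite mul0r.
have -> : (v ^+ 2 - u * w) * z ^+ 2 = (v * z) ^+ 2 - u * (w * z ^+ 2) by ring.
by rewrite vE -e3; ring.
Qed.

Variables f0 f1 f2 : {poly K}.
Let D := f1 ^+ 2 - 4 *: (f0 * f2).
Hypothesis sD : size D = 5%N.
Hypothesis f_coprime : forall t, ~~ [&& root f0 t, root f1 t & root f2 t].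
Hypothesis D_simple : forall t, root D t -> ~~ root D^`() t.

Let f0_neq0 : f0 != 0.
Proof.
apply/eqP => f00; have [|a Da] := @closed_rootP _ D _; first by rewrite sD.
have := square_times_simple (p := 1) (q := f1) Da (D_simple Da).
rewrite /D f00 mul0r scaler0 subr0 expr1n mulr1 => /(_ erefl) /eqP.
by rewrite oner_eq0.
Qed.

(** The forms are proportional over K(t).  The factor is a polynomial because
    f0, f1, f2 have no common root, and a constant because one of them has
    degree 2. *)
Lemma proportional_of_minors g0 g1 g2 :
  (size g0 <= 3)%N -> (size g1 <= 3)%N -> (size g2 <= 3)%N ->
  minor f0 g0 f1 g1 = 0 -> minor f0 g0 f2 g2 = 0 ->
  exists k, [/\ g0 = k *: f0, g1 = k *: f1 & g2 = k *: f2].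
Proof.
move=> sg0 sg1 sg2 /eqP; rewrite subr_eq0 => /eqP m01 /eqP; rewrite subr_eq0 => /eqP m02.
have cop : coprimep f0 (gcdp f1 f2).
  apply/Pdiv.ClosedField.coprimepP => t f0t; rewrite -[_ != 0]/(~~ root _ t) root_gcd.
  by have := f_coprime t; rewrite f0t.
have /dvdpP[k kE] : f0 %| g0.
  rewrite -(Gauss_dvdpl _ cop) (eqp_dvdr _ (mulp_gcdr _ _ _)) dvdp_gcd.
  by rewrite ![g0 * _]mulrC -m01 -m02 !dvdp_mulr.
have gE f g : f0 * g = f * g0 -> g = k * f.
  by move=> fg; apply: (mulfI f0_neq0); rewrite fg kE; ring.
have [g1E g2E] := (gE _ _ m01, gE _ _ m02).
have sk : (size k <= 1)%N.
  have size_k f g : g = k * f -> (size g <= 3)%N -> (2 < size f)%N -> (size k <= 1)%N.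
    move=> -> + sf; have [->|k0] := eqVneq k 0; first by rewrite size_poly0.
    have f0' : f != 0 by rewrite -size_poly_gt0 (leq_trans _ sf).
    rewrite size_mul // -subn1 leq_subLR => skf; rewrite -(leq_add2r 3).
    by apply: leq_trans skf; rewrite leq_add2l.
  have [s0|/(size_k _ _ kE sg0)//] := leqP (size f0) 2.
  have [s1|/(size_k _ _ g1E sg1)//] := leqP (size f1) 2.
  have [s2|/(size_k _ _ g2E sg2)//] := leqP (size f2) 2.
  have : (size D <= 3)%N.
    rewrite (leq_trans (size_polyD _ _)) // geq_max size_polyN expr2 size_square_le3 //=.
    by rewrite (leq_trans (size_scale_leq _ _)) // size_square_le3.
  by rewrite sD.
by exists k`_0; rewrite -!mul_polyC -(size1_polyC sk).
Qed.

(** A vanishing resultant provides a common root of the forms over K(t).  If the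
    forms were not proportional, the minors would express this root rationally,
    and D would be a square in K(t), whereas its roots are simple. *)
Lemma common_component g0 g1 g2 :
  (size g0 <= 3)%N -> (size g1 <= 3)%N -> (size g2 <= 3)%N ->
  quadratic_resultant f0 f1 f2 g0 g1 g2 = 0 ->
  exists k, [/\ g0 = k *: f0, g1 = k *: f1 & g2 = k *: f2].
Proof.
move=> sg0 sg1 sg2 R0.
have [|a Da] := @closed_rootP _ D _; first by rewrite sD.
have det0 : f0 * minor f1 g1 f2 g2 - f1 * minor f0 g0 f2 g2 + f2 * minor f0 g0 f1 g1 = 0.
  by rewrite /minor; ring.
move: R0; rewrite /quadratic_resultant => /eqP; rewrite subr_eq0 => /eqP.
pose u := minor f0 g0 f1 g1; pose v := minor f0 g0 f2 g2; pose w := minor f1 g1 f2 g2.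
rewrite -/u -/v -/w in det0 * => vuw.
(* The relation f0 v^2 - f1 u v + f2 u^2 = 0 follows from det0 and vuw;
   completing the square in it makes D u^2 a square. *)
have sq : (f1 * u - 2 * (f0 * v)) ^+ 2 = D * u ^+ 2.
  rewrite /D -mul_polyC polyC_natr; apply/eqP; rewrite -subr_eq0; apply/eqP.
  have -> : (f1 * u - 2 * (f0 * v)) ^+ 2 - (f1 ^+ 2 - 4 * (f0 * f2)) * u ^+ 2 =
    4 * f0 * (f0 * (v ^+ 2) - f1 * u * v + f2 * u ^+ 2) by ring.
  have -> : f0 * (v ^+ 2) - f1 * u * v + f2 * u ^+ 2 = u * (f0 * w - f1 * v + f2 * u).
    by rewrite vuw; ring.
  by rewrite det0 !mulr0.
have u0 : u = 0 := square_times_simple Da (D_simple Da) sq.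
have v0 : v = 0 by apply/eqP; rewrite -sqrf_eq0 vuw u0 mul0r.
exact: proportional_of_minors.
Qed.

End CommonComponent.

Section SmoothPencil.
Variables (K : numClosedFieldType) (f0 f1 f2 : {poly K}).
Let D := f1 ^+ 2 - 4 *: (f0 * f2).
Hypothesis smooth : forall t y z : K, (y != 0) || (z != 0) ->
  2 * f0.[t] * y + f1.[t] * z = 0 -> f1.[t] * y + 2 * f2.[t] * z = 0 ->
  f0^`().[t] * y ^+ 2 + f1^`().[t] * (y * z) + f2^`().[t] * z ^+ 2 != 0.

(** If the form vanished identically above t, its derivative along the first
    line would be a quadratic form on the fibre, and a zero of it would be a
    singular point. *)
Lemma smooth_coprime t : ~~ [&& root f0 t, root f1 t & root f2 t].
Proof.
apply/and3P => -[/rootP r0 /rootP r1 /rootP r2].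
have [y [z [yz0 yzE]]] := binary_quadratic_zero f0^`().[t] f1^`().[t] f2^`().[t].
have := smooth (t := t) yz0; rewrite r0 r1 r2 yzE eqxx => absurd.
by suff: false by []; apply: absurd; ring.
Qed.

(** Above a root t of D the form has a double root, and the derivative of D at t
    is a nonzero multiple of the derivative along the first line of the form at
    this double root. *)
Lemma smooth_discriminant_simple t : root D t -> ~~ root D^`() t.
Proof.
rewrite !rootE /D expr2 !(derivB, derivZ, derivM) !(hornerD, hornerN, hornerM, hornerZ) subr_eq0.
move=> /eqP Dt; have smt := smooth (t := t).
have cop := smooth_coprime t; rewrite !rootE in cop.
move: smt cop Dt; move: f0.[t] f1.[t] f2.[t] f0^`().[t] f1^`().[t] f2^`().[t].
move=> a b c a' b' c' smt cop Dt.
have [a0|a0] := eqVneq a 0.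
  have b0 : b = 0 by apply/eqP; rewrite -sqrf_eq0 expr2 Dt a0; apply/eqP; ring.
  have c0 : c != 0 by rewrite a0 b0 !eqxx in cop.
  apply/eqP => D'0.
  have : a' * 1 ^+ 2 + b' * (1 * 0) + c' * 0 ^+ 2 != 0.
    by apply: smt; rewrite ?oner_eq0 // ?a0 ?b0; ring.
  apply/negP; rewrite negbK; apply/eqP.
  apply: (mulIf (_ : 4 * c != 0)); first by rewrite mulf_neq0 // pnatr_eq0.
  transitivity (- 0 : K); last by rewrite oppr0 mul0r.
  by rewrite -[in RHS]D'0 a0 b0; ring.
apply/eqP => D'0.
(* The double root of a y^2 + b y z + c z^2 is (- b : 2 a). *)
have : a' * (- b) ^+ 2 + b' * ((- b) * (2 * a)) + c' * (2 * a) ^+ 2 != 0.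
  apply: smt; first by rewrite mulf_neq0 ?orbT // two_neq0.
    by ring.
  have -> : b * (- b) + 2 * c * (2 * a) = 4 * (a * c) - b * b by ring.
  by rewrite Dt subrr.
have -> : a' * (- b) ^+ 2 + b' * (- b * (2 * a)) + c' * (2 * a) ^+ 2 =
  a' * (b * b) - 2 * a * b * b' + 4 * a ^+ 2 * c' by ring.
apply/negP; rewrite negbK Dt; apply/eqP; transitivity (a * - 0); last by rewrite oppr0 mulr0.
by rewrite -[in RHS]D'0; ring.
Qed.

End SmoothPencil.

(** * Symmetric matrices in block form *)

Section SymmetricMatrices.
Variable K : numClosedFieldType.
Implicit Types N : 'M[K]_4.

(** In block form N consists of its restrictions to the first two and to the
    last two coordinates and of a pairing between them.  The first is read on
    the vectors (t, 1, 0, 0), and [chart_m] pairs these with the last two basis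
    vectors. *)
Definition chart_u N : {poly K} := N 0 0 *: 'X^2 + (2 * N 0 1) *: 'X + (N 1 1)%:P.
Definition chart_m N (j : 'I_4) : {poly K} := N 0 j *: 'X + (N 1 j)%:P.

(** The (2,2)-form of N at ([t, 1], [y, z]) is [tangency0 N] y^2 + [tangency1 N]
    y z + [tangency2 N] z^2; see [tangencyE]. *)
Definition tangency0 N : {poly K} := N 2 2 *: chart_u N - chart_m N 2 ^+ 2.
Definition tangency1 N : {poly K} :=
  (2 * N 2 3) *: chart_u N - 2 *: (chart_m N 2 * chart_m N 3).
Definition tangency2 N : {poly K} := N 3 3 *: chart_u N - chart_m N 3 ^+ 2.

Definition tangency_scaled lam N N' : Prop :=
  [/\ tangency0 N' = lam *: tangency0 N, tangency1 N' = lam *: tangency1 N &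
      tangency2 N' = lam *: tangency2 N].

(** Multiplies the three blocks of N by x, y and z.  For x z = y^2 this is, up
    to a scalar, the action of independent homotheties of the two lines, and the
    (2,2)-form is only multiplied by y^2. *)
Definition torus x y z N : 'M[K]_4 := \matrix_(i, j)
  ((if (i < 2)%N then if (j < 2)%N then x else y else if (j < 2)%N then y else z) * N i j).

Lemma torus_linear x y z N :
  torus x y z N = x *: torus 1 0 0 N + y *: torus 0 1 0 N + z *: torus 0 0 1 N.
Proof.
apply/matrixP => i j; rewrite !mxE; do 2!case: ifP => _; ring.
Qed.

Lemma torus_sym x y z N : N^T = N -> (torus x y z N)^T = torus x y z N.
Proof.
move=> symN; apply/matrixP => i j; rewrite !mxE -[in LHS]symN mxE.
by do 2!case: ifP => _.
Qed.

Lemma size_chart_u N : (size (chart_u N) <= 3)%N.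
Proof.
rewrite (leq_trans (size_polyD _ _)) // geq_max (leq_trans (size_polyC_leq1 _)) // andbT.
rewrite (leq_trans (size_polyD _ _)) // geq_max !(leq_trans (size_scale_leq _ _)) //.
  by rewrite size_polyX.
by rewrite size_polyXn.
Qed.

Lemma size_chart_m N j : (size (chart_m N j) <= 2)%N.
Proof.
apply: leq_trans (size_polyD _ _) _; rewrite geq_max.
by rewrite (leq_trans (size_scale_leq _ _)) ?size_polyX // (leq_trans (size_polyC_leq1 _)).
Qed.

Lemma size_tangency N :
  [/\ (size (tangency0 N) <= 3)%N, (size (tangency1 N) <= 3)%N & (size (tangency2 N) <= 3)%N].
Proof.
have sizeB c (p : {poly K}) : (size p <= 3)%N -> (size (c *: chart_u N - p)%R <= 3)%N.
  move=> sp; rewrite (leq_trans (size_polyD _ _)) // geq_max size_polyN sp andbT.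
  exact: leq_trans (size_scale_leq _ _) (size_chart_u N).
by split; apply: sizeB; rewrite ?(leq_trans (size_scale_leq _ _)) ?size_square_le3 ?size_chart_m.
Qed.

Lemma tangency_scaledP lam N N' : tangency_scaled lam N N' <->
  pencil_solution (tangency0 N) (tangency1 N) (tangency2 N) lam
    (chart_u N') (chart_m N' 2) (chart_m N' 3) (N' 2 2) (2 * N' 2 3) (N' 3 3).
Proof. by split=> [|[_ _ _]//]; split=> //; rewrite ?size_chart_u ?size_chart_m. Qed.

Lemma coef_chart_u N : [/\ (chart_u N)`_0 = N 1 1, (chart_u N)`_1 = 2 * N 0 1 & (chart_u N)`_2 = N 0 0].
Proof.
by split; rewrite !coefD !coefZ coefXn coefX coefC /= !(mulr0, mulr1, addr0, add0r).
Qed.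

Lemma coef_chart_m N j : (chart_m N j)`_0 = N 1 j /\ (chart_m N j)`_1 = N 0 j.
Proof.
by split; rewrite !coefD !coefZ coefX coefC /= !(mulr0, mulr1, addr0, add0r).
Qed.

Lemma ord4_cases (P : 'I_4 -> Prop) : P 0 -> P 1 -> P 2 -> P 3 -> forall i, P i.
Proof.
move=> P0 P1 P2 P3 -[[|[|[|[|//]]]] lt_i].
- by rewrite (_ : Ordinal _ = 0) //; apply: val_inj.
- by rewrite (_ : Ordinal _ = 1) //; apply: val_inj.
- by rewrite (_ : Ordinal _ = 2) //; apply: val_inj.
- by rewrite (_ : Ordinal _ = 3) //; apply: val_inj.
Qed.

Lemma sym_mx_ext N N' : N^T = N -> N'^T = N' ->
  chart_u N = chart_u N' -> chart_m N 2 = chart_m N' 2 -> chart_m N 3 = chart_m N' 3 ->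
  N 2 2 = N' 2 2 -> 2 * N 2 3 = 2 * N' 2 3 -> N 3 3 = N' 3 3 -> N = N'.
Proof.
move=> symN symN' eu e2 e3 e22 /(mulfI (two_neq0 K)) e23 e33.
have [u0 u1 u2] := coef_chart_u N; have [u0' u1' u2'] := coef_chart_u N'.
have [m20 m21] := coef_chart_m N 2; have [m20' m21'] := coef_chart_m N' 2.
have [m30 m31] := coef_chart_m N 3; have [m30' m31'] := coef_chart_m N' 3.
have e00 : N 0 0 = N' 0 0 by rewrite -u2 -u2' eu.
have e01 : N 0 1 = N' 0 1 by apply: (mulfI (two_neq0 K)); rewrite -u1 -u1' eu.
have e11 : N 1 1 = N' 1 1 by rewrite -u0 -u0' eu.
have e02 : N 0 2 = N' 0 2 by rewrite -m21 -m21' e2.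
have e12 : N 1 2 = N' 1 2 by rewrite -m20 -m20' e2.
have e03 : N 0 3 = N' 0 3 by rewrite -m31 -m31' e3.
have e13 : N 1 3 = N' 1 3 by rewrite -m30 -m30' e3.
have swap i j : N i j = N' i j -> N j i = N' j i.
  by move=> e; rewrite -symN -symN' !mxE.
apply/matrixP; apply: ord4_cases; apply: ord4_cases => //; exact: swap.
Qed.

Lemma chart_mx_exists (al L M : {poly K}) (g0 g1 g2 : K) :
  (size al <= 3)%N -> (size L <= 2)%N -> (size M <= 2)%N -> exists N,
  [/\ N^T = N, chart_u N = al, chart_m N 2 = L, chart_m N 3 = M &
      [/\ N 2 2 = g0, 2 * N 2 3 = g1 & N 3 3 = g2]].
Proof.
move=> sal sL sM.
pose entry (i j : nat) : K := match minn i j, maxn i j return K with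
  | 0, 0 => al`_2 | 0, 1 => al`_1 / 2 | 1, 1 => al`_0
  | 0, 2 => L`_1 | 1, 2 => L`_0 | 0, 3 => M`_1 | 1, 3 => M`_0
  | 2, 2 => g0 | 2, 3 => g1 / 2 | _, _ => g2 end.
pose N : 'M[K]_4 := \matrix_(i, j) entry i j.
have half (x : K) : 2 * (x / 2) = x by rewrite mulrC divfK ?two_neq0.
have poly2E (p : {poly K}) : (size p <= 2)%N -> p`_1 *: 'X + (p`_0)%:P = p.
  move=> sp; apply/polyP => -[|[|i]]; rewrite coefD coefZ coefX coefC /= ?(mulr0, mulr1, addr0, add0r) //.
  by rewrite nth_default // (leq_trans sp).
exists N; split; rewrite /chart_u /chart_m ?mxE /entry /= ?half ?poly2E //.
  by apply/matrixP => i j; rewrite !mxE /entry minnC maxnC.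
apply/polyP => -[|[|[|i]]]; rewrite !coefD !coefZ coefXn coefX coefC /= ?(mulr0, mulr1, addr0, add0r) //.
by rewrite nth_default // (leq_trans sal).
Qed.

Lemma chart_torus x y z N : chart_u (torus x y z N) = x *: chart_u N /\
  forall j : 'I_4, (1 < j)%N -> chart_m (torus x y z N) j = y *: chart_m N j.
Proof.
split=> [|j lt1j]; rewrite /chart_u /chart_m !mxE /= ?[(j < 2)%N]ltnNge ?lt1j /=.
  by rewrite -!mul_polyC !polyCM; ring.
by rewrite -!mul_polyC !polyCM; ring.
Qed.

Lemma tangency_torus x y z N : x * z = y ^+ 2 ->
  tangency_scaled (y ^+ 2) N (torus x y z N).
Proof.
move=> xz; have [uE mE] := chart_torus x y z N.
have {}xz : x%:P * z%:P = y%:P ^+ 2 by rewrite -polyCM xz polyC_exp.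
split; rewrite /tangency0 /tangency1 /tangency2 uE !mE // !mxE /=.
- rewrite -!mul_polyC !(polyCM, polyC_exp) -xz exprMn -xz; ring.
- rewrite -!mul_polyC !(polyCM, polyC_exp) -xz.
  transitivity (2%:P * (x%:P * z%:P) * (N 2 3)%:P * chart_u N - 2%:P * (y%:P ^+ 2) * (chart_m N 2 * chart_m N 3)).
    by ring.
  by rewrite -xz; ring.
- rewrite -!mul_polyC !(polyCM, polyC_exp) -xz exprMn -xz; ring.
Qed.

End SymmetricMatrices.

Section SymmetricPencil.
Variables (K : numClosedFieldType) (N0 : 'M[K]_4).
Let D := tangency1 N0 ^+ 2 - 4 *: (tangency0 N0 * tangency2 N0).
Hypothesis sD : size D = 5%N.
Hypothesis coprime0 : forall t, ~~ [&& root (tangency0 N0) t, root (tangency1 N0) t & root (tangency2 N0) t].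
Hypothesis D_simple : forall t, root D t -> ~~ root D^`() t.

(** The blocks of a symmetric matrix hold the coefficients of al, of L and M,
    and of ga, so that the twelve families of [pencil_solutions] are twelve
    torus orbits of matrices. *)
Lemma symmetric_pencil : exists N : 'I_6 * bool -> 'M[K]_4,
  [/\ forall k, (N k)^T = N k /\ tangency_scaled 1 N0 (N k),
      forall k, [/\ torus 1 0 0 (N k) != 0, torus 0 1 0 (N k) != 0 & torus 0 0 1 (N k) != 0],
      forall k k' x y, torus 1 0 0 (N k) = torus x 0 0 (N k') ->
        torus 0 1 0 (N k) = torus 0 y 0 (N k') -> k = k' &
      forall lam N', N'^T = N' -> lam != 0 -> tangency_scaled lam N0 N' ->
        exists k c nu, [/\ c != 0, nu != 0 & N' = torus c nu (nu ^+ 2 / c) (N k)]].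
Proof.
have [s0 s1 s2] := size_tangency N0.
have [al [L [M [g0 [g1 [g2 [sol nz inj all_sol]]]]]]] := pencil_solutions s0 s1 s2 sD coprime0 D_simple.
have /fin_all_exists[N NP] k : exists N : 'M[K]_4,
    [/\ N^T = N, chart_u N = al k, chart_m N 2 = L k, chart_m N 3 = M k &
      [/\ N 2 2 = g0 k, 2 * N 2 3 = g1 k & N 3 3 = g2 k]].
  by have [sal sL sM _] := sol k; exact: chart_mx_exists.
have u0 k x y z : torus x y z (N k) = 0 -> x *: al k = 0.
  have [_ <- _ _ _] := NP k; have [<- _] := chart_torus x y z (N k) => ->.
  by rewrite /chart_u !mxE mulr0 !scale0r !addr0.
have m0 k x y z : torus x y z (N k) = 0 -> y *: L k = 0 /\ y *: M k = 0.
  have [_ _ <- <- _] := NP k; have [_ mE] := chart_torus x y z (N k).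
  by rewrite -!mE // => ->; rewrite /chart_m !mxE !scale0r addr0.
exists N; split.
- move=> k; have [symN uE LE ME [g0E g1E g2E]] := NP k; split=> //.
  by apply/tangency_scaledP; rewrite uE LE ME g0E g1E g2E.
- move=> k; have [al0 LM0 g0'] := nz k; have [symN uE LE ME [g0E g1E g2E]] := NP k; split.
  + by apply: contra_neq al0 => /u0; rewrite scale1r.
  + by apply: contra_neq LM0 => /m0[]; rewrite !scale1r => -> ->.
  + apply: contra_neq g0' => /matrixP N0'.
    have := N0' 2 2; have := N0' 2 3; have := N0' 3 3; rewrite !mxE /= !mul1r -g0E -g1E -g2E.
    by move=> -> -> ->; rewrite mulr0.
- move=> k k' x y uE mE; apply: (inj k k' x y).
  + have [_ <- _ _ _] := NP k; have [_ <- _ _ _] := NP k'.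
    have [<- _] := chart_torus x 0 0 (N k'); rewrite -uE.
    by have [-> _] := chart_torus 1 0 0 (N k); rewrite scale1r.
  + have [_ _ <- _ _] := NP k; have [_ _ <- _ _] := NP k'.
    have [_ <- //] := chart_torus 0 y 0 (N k'); rewrite -mE.
    by have [_ -> //] := chart_torus 0 1 0 (N k); rewrite scale1r.
  + have [_ _ _ <- _] := NP k; have [_ _ _ <- _] := NP k'.
    have [_ <- //] := chart_torus 0 y 0 (N k'); rewrite -mE.
    by have [_ -> //] := chart_torus 0 1 0 (N k); rewrite scale1r.
move=> lam N' symN' lam0 /tangency_scaledP/(all_sol _ _ _ _ _ _ _ lam0).
move=> [k [c [nu [c0 nu0 uE [LE ME] [g0E g1E g2E]]]]]; exists k, c, nu; split=> //.
have [symN uE' LE' ME' [g0E' g1E' g2E']] := NP k.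
have [uT mT] := chart_torus c nu (nu ^+ 2 / c) (N k).
apply: sym_mx_ext => //; first exact: torus_sym.
- by rewrite uT uE' uE.
- by rewrite mT // LE' LE.
- by rewrite mT // ME' ME.
- by rewrite !mxE /= g0E' g0E.
- by rewrite !mxE /= mulrCA g1E' g1E.
- by rewrite !mxE /= g2E' g2E.
Qed.

End SymmetricPencil.

(** * The (2,2)-form of a quadric *)

Section TangencyForm.

Lemma sum_ord4 (V : nmodType) (F : 'I_4 -> V) : \sum_i F i = F 0 + F 1 + F 2 + F 3.
Proof.
rewrite !big_ord_recl big_ord0 addr0 !addrA.
by congr (_ + F _ + F _ + F _); apply: val_inj.
Qed.

Lemma sum_pairs (V : nmodType) (F : 'I_4 * 'I_4 -> V) :
  \sum_(I < 6) F (idx2 I) = F (0, 1) + F (0, 2) + F (0, 3) + F (1, 2) + F (1, 3) + F (2, 3).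
Proof. by rewrite !big_ord_recl big_ord0 addr0 !addrA. Qed.

(** The Cauchy-Binet formula for the 2 x 4 matrix with rows u and v. *)
Lemma wedge2_pluecker (A : comNzRingType) (M : 'M[A]_4) (u v : 'rV[A]_4) :
  ((pluecker u v)^T *m wedge2 M *m pluecker u v) 0 0 =
  (u *m M *m u^T) 0 0 * (v *m M *m v^T) 0 0 - (u *m M *m v^T) 0 0 * (v *m M *m u^T) 0 0.
Proof.
pose p (ij : 'I_4 * 'I_4) := u 0 ij.1 * v 0 ij.2 - u 0 ij.2 * v 0 ij.1.
pose W (ij kl : 'I_4 * 'I_4) := M ij.1 kl.1 * M ij.2 kl.2 - M ij.1 kl.2 * M ij.2 kl.1.
transitivity (\sum_(J < 6) (\sum_(I < 6) p (idx2 I) * W (idx2 I) (idx2 J)) * p (idx2 J)).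
  rewrite mxE; apply: eq_bigr => J _; rewrite !mxE; congr (_ * _); last first.
    by rewrite /p; case: (idx2 J).
  apply: eq_bigr => I _; rewrite !mxE; congr (_ * _).
    by rewrite /p; case: (idx2 I).
  by rewrite /W; case: (idx2 I) => i i'; case: (idx2 J) => j j'.
rewrite (sum_pairs (fun J => (\sum_(I < 6) p (idx2 I) * W (idx2 I) J) * p J)).
rewrite !(sum_pairs (fun I => p I * W I _)) /p /W /=.
have bil (x y : 'rV[A]_4) : (x *m M *m y^T) 0 0 =
    \sum_j (\sum_i x 0 i * M i j) * y 0 j.
  by rewrite mxE; apply: eq_bigr => j _; rewrite !mxE.
rewrite !bil !sum_ord4; ring.
Qed.

Definition gram (A : comNzRingType) (P M : 'M[A]_4) : 'M[A]_4 := P *m M *m P^T.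

Lemma gramE (A : comNzRingType) (P M : 'M[A]_4) i j :
  gram P M i j = (row i P *m M *m (row j P)^T) 0 0.
Proof.
rewrite tr_row -row_mul !mxE; apply: eq_bigr => k _.
by rewrite [row _ _ _ _]mxE [col _ _ _ _]mxE.
Qed.

Lemma bilinear_combination (A : comNzRingType) (M : 'M[A]_4) (a b c d : 'rV[A]_4) w x y z :
  ((w *: a + x *: b) *m M *m (y *: c + z *: d)^T) 0 0 =
  w * y * (a *m M *m c^T) 0 0 + w * z * (a *m M *m d^T) 0 0 +
  x * y * (b *m M *m c^T) 0 0 + x * z * (b *m M *m d^T) 0 0.
Proof.
rewrite !linearD !linearZ /= !mulmxDl -!scalemxAl.
by move: (a *m M *m c^T) (a *m M *m d^T) (b *m M *m c^T) (b *m M *m d^T) => ? ? ? ?; rewrite !mxE; ring.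
Qed.

Definition basis (A : nmodType) (a b c d : 'rV[A]_4) : 'M[A]_4 :=
  \matrix_(i < 4) nth 0 [:: a; b; c; d] i.

(** For a symmetric T this is the Gram determinant of the vectors (w, x, 0, 0)
    and (0, 0, y, z). *)
Definition biquadric (A : comNzRingType) (T : 'M[A]_4) (w x y z : A) : A :=
  (T 0 0 * w ^+ 2 + 2 * T 0 1 * (w * x) + T 1 1 * x ^+ 2) *
  (T 2 2 * y ^+ 2 + 2 * T 2 3 * (y * z) + T 3 3 * z ^+ 2) -
  (T 0 2 * (w * y) + T 0 3 * (w * z) + T 1 2 * (x * y) + T 1 3 * (x * z)) ^+ 2.

Lemma biquadric_bilinear (A : comNzRingType) (M : 'M[A]_4) (a b c d : 'rV[A]_4) w x y z :
  M^T = M ->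
  let u := w *: a + x *: b in let v := y *: c + z *: d in
  (u *m M *m u^T) 0 0 * (v *m M *m v^T) 0 0 - (u *m M *m v^T) 0 0 * (v *m M *m u^T) 0 0 =
  biquadric (gram (basis a b c d) M) w x y z.
Proof.
move=> symM u v.
have swap (e f : 'rV[A]_4) : (e *m M *m f^T) 0 0 = (f *m M *m e^T) 0 0.
  have -> : f *m M *m e^T = (e *m M *m f^T)^T by rewrite !trmx_mul trmxK symM mulmxA.
  by move: (e *m M *m f^T) => N; rewrite mxE.
rewrite (swap v u) /u /v !bilinear_combination /biquadric !gramE !rowK /= (swap b a) (swap d c).
ring.
Qed.

Lemma biquadric_map (A B : comNzRingType) (f : {rmorphism A -> B}) (T : 'M[A]_4) w x y z :
  f (biquadric T w x y z) = biquadric (map_mx f T) (f w) (f x) (f y) (f z).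
Proof.
rewrite /biquadric !mxE !(rmorphB, rmorphD, rmorphM, rmorphXn, rmorph_nat) /=.
by rewrite !rmorph1; ring.
Qed.

(** Nine values determine a biquadratic form, so one that vanishes at all points
    of the base ring vanishes formally. *)
Lemma biquadric_interpolation (A : comNzRingType) (T : 'M[A]_4) w x y z :
  let F := biquadric T in
  biquadric T w x y z =
    w ^+ 2 * y ^+ 2 * F 1 0 1 0 + w ^+ 2 * z ^+ 2 * F 1 0 0 1 +
    w ^+ 2 * (y * z) * (F 1 0 1 1 - F 1 0 1 0 - F 1 0 0 1) +
    x ^+ 2 * y ^+ 2 * F 0 1 1 0 + x ^+ 2 * z ^+ 2 * F 0 1 0 1 +
    x ^+ 2 * (y * z) * (F 0 1 1 1 - F 0 1 1 0 - F 0 1 0 1) +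
    w * x * y ^+ 2 * (F 1 1 1 0 - F 1 0 1 0 - F 0 1 1 0) +
    w * x * z ^+ 2 * (F 1 1 0 1 - F 1 0 0 1 - F 0 1 0 1) +
    w * x * (y * z) * (F 1 1 1 1 - F 1 1 1 0 - F 1 1 0 1 - F 1 0 1 1 - F 0 1 1 1 +
      F 1 0 1 0 + F 1 0 0 1 + F 0 1 1 0 + F 0 1 0 1).
Proof. by move=> F; rewrite /F /biquadric; ring. Qed.

(** The partial derivatives of [biquadric T], in the order w, x, y, z. *)
Definition biquadric_grad (A : comNzRingType) (T : 'M[A]_4) (i : 'I_4) (w x y z : A) : A :=
  let qu := T 0 0 * w ^+ 2 + 2 * T 0 1 * (w * x) + T 1 1 * x ^+ 2 in
  let qv := T 2 2 * y ^+ 2 + 2 * T 2 3 * (y * z) + T 3 3 * z ^+ 2 in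
  let b := T 0 2 * (w * y) + T 0 3 * (w * z) + T 1 2 * (x * y) + T 1 3 * (x * z) in
  2 * nth 0 [:: (T 0 0 * w + T 0 1 * x) * qv - b * (T 0 2 * y + T 0 3 * z);
                (T 0 1 * w + T 1 1 * x) * qv - b * (T 1 2 * y + T 1 3 * z);
                qu * (T 2 2 * y + T 2 3 * z) - b * (T 0 2 * w + T 1 2 * x);
                qu * (T 2 3 * y + T 3 3 * z) - b * (T 0 3 * w + T 1 3 * x)] i.

Lemma biquadric_map_eq0 (A B : comNzRingType) (f : {rmorphism A -> B}) (T : 'M[A]_4) :
  (forall w x y z, biquadric T w x y z = 0) ->
  forall w x y z, biquadric (map_mx f T) w x y z = 0.
Proof.
move=> T0 w x y z; rewrite biquadric_interpolation.
have C0 w' x' y' z' : biquadric (map_mx f T) (f w') (f x') (f y') (f z') = 0.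
  by rewrite -biquadric_map T0 rmorph0.
have := (C0 1 0 1 0, C0 1 0 0 1, C0 1 0 1 1, C0 0 1 1 0, C0 0 1 0 1, C0 0 1 1 1,
  C0 1 1 1 0, C0 1 1 0 1, C0 1 1 1 1).
by rewrite !rmorph0 !rmorph1 => E; rewrite !E !(mulr0, subr0, addr0).
Qed.

Lemma map_gram (A B : comNzRingType) (f : {rmorphism A -> B}) (P M : 'M[A]_4) :
  gram (map_mx f P) (map_mx f M) = map_mx f (gram P M).
Proof. by rewrite /gram map_trmx !map_mxM. Qed.

Lemma map_basis (A B : nmodType) (f : A -> B) (a b c d : 'rV[A]_4) :
  basis (map_mx f a) (map_mx f b) (map_mx f c) (map_mx f d) = map_mx f (basis a b c d).
Proof. by apply/row_matrixP; apply: ord4_cases; rewrite -map_row !rowK. Qed.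

End TangencyForm.

Section Form22.
Variables (K : numClosedFieldType) (a b c d : 'rV[K]_4) (Q : quadric K).
Let T := gram (basis a b c d) (quadric_mx Q).

Lemma quadric_mx_sym : (quadric_mx Q)^T = quadric_mx Q.
Proof. by apply/sym_mxP; exists (coords Q). Qed.

Lemma form22E : form22 a b c d Q =
  biquadric (map_mx (@mpolyC 4 K) T) 'X_0 'X_1 'X_2 'X_3.
Proof.
rewrite /form22 /pluecker_transversal wedge2_pluecker biquadric_bilinear; last first.
  by rewrite map_trmx quadric_mx_sym.
by rewrite map_basis map_gram.
Qed.

Lemma form22_eval (v : 'I_4 -> K) :
  (form22 a b c d Q).@[v] = biquadric T (v 0) (v 1) (v 2) (v 3).
Proof.
rewrite form22E (biquadric_map (meval v)) /= !mevalXU.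
by congr (biquadric _ _ _ _ _); apply/matrixP => i j; rewrite !mxE mevalC.
Qed.

Lemma form22_eq0 : (forall w x y z, biquadric T w x y z = 0) -> form22 a b c d Q = 0.
Proof.
by move=> T0; rewrite form22E; apply: biquadric_map_eq0.
Qed.

Lemma form22_grad (v : 'I_4 -> K) i :
  ((form22 a b c d Q)^`M(i)).@[v] = biquadric_grad T i (v 0) (v 1) (v 2) (v 3).
Proof.
rewrite form22E; move: (T) => N; rewrite /biquadric !mxE; pose S := {mpoly K[4]}.
have two_mp : (2 : S) = 2%:MP by rewrite mpolyC_nat.
rewrite two_mp !expr2; pose delta (p : S) := (p^`M(i)).@[v].
have dM (p q : S) : delta (p * q) = delta p * q.@[v] + p.@[v] * delta q.
  by rewrite /delta mderivM mevalD !mevalM.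
have dD (p q : S) : delta (p + q) = delta p + delta q by rewrite /delta mderivD mevalD.
have dB (p q : S) : delta (p - q) = delta p - delta q by rewrite /delta mderivB mevalB.
have dC t : delta t%:MP = 0 by rewrite /delta mderivC meval0.
have dX j : delta 'X_j = (j == i :> nat)%:R.
  rewrite /delta mderivX mevalZ mnm1E -val_eqE.
  case: (eqVneq (val j) i) => [/val_inj ->|_]; last by rewrite mul0r.
  rewrite mul1r (_ : (U_(i) - U_(i))%MM = 0%MM) ?mpolyX0 ?meval1 //.
  by apply/mnmP => j'; rewrite !mnmE subnn.
rewrite -[LHS]/(delta _) !(dB, dD, dM, dC, dX) !(mevalD, mevalM, mevalC, mevalXU).
rewrite /biquadric_grad; move: i {delta dM dD dB dC dX}; apply: ord4_cases => /=; ring.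
Qed.

End Form22.

(** * Choice of a basis of the first line *)

Section ChangeOfBasis.
Variable K : numClosedFieldType.
Implicit Types (T : 'M[K]_4).

Definition frame_change (p q r s : K) : 'M[K]_4 := \matrix_(i, j)
  nth 0 (nth [::] [:: [:: p; q]; [:: r; s]; [:: 0; 0; 1; 0]; [:: 0; 0; 0; 1]] i) j.

Lemma frame_changeE (a b c d : 'rV[K]_4) p q r s :
  basis (p *: a + q *: b) (r *: a + s *: b) c d = frame_change p q r s *m basis a b c d.
Proof.
apply/row_matrixP; apply: ord4_cases; rewrite row_mul rowK; apply/rowP => j;
by rewrite [RHS]mxE sum_ord4 !mxE /=; ring.
Qed.

Lemma gram_mul (G P M : 'M[K]_4) : gram (G *m P) M = gram G (gram P M).
Proof. by rewrite /gram trmx_mul !mulmxA. Qed.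

Lemma gram_sym (P M : 'M[K]_4) : M^T = M -> (gram P M)^T = gram P M.
Proof. by move=> symM; rewrite /gram !trmx_mul trmxK symM mulmxA. Qed.

Lemma gram_frame_changeE p q r s T : T^T = T -> let T' := gram (frame_change p q r s) T in
  [/\ T' 0 0 = p ^+ 2 * T 0 0 + 2 * p * q * T 0 1 + q ^+ 2 * T 1 1,
      T' 0 1 = p * r * T 0 0 + (p * s + q * r) * T 0 1 + q * s * T 1 1,
      T' 1 1 = r ^+ 2 * T 0 0 + 2 * r * s * T 0 1 + s ^+ 2 * T 1 1,
      forall j : 'I_4, (1 < j)%N ->
        T' 0 j = p * T 0 j + q * T 1 j /\ T' 1 j = r * T 0 j + s * T 1 j &
      forall i j : 'I_4, (1 < i)%N -> (1 < j)%N -> T' i j = T i j].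
Proof.
move=> symT T'; have T'E i j : T' i j = \sum_k (\sum_l frame_change p q r s i l * T l k) * frame_change p q r s j k.
  by rewrite mxE; apply: eq_bigr => k _; rewrite !mxE; congr (_ * _); apply: eq_bigr => l _; rewrite !mxE.
have T10 : T 1 0 = T 0 1 by rewrite -[in LHS]symT mxE.
split; rewrite ?T'E ?sum_ord4 ?mxE ?sum_ord4 ?mxE /= ?T10; try ring.
  by apply: ord4_cases => //= _; rewrite !T'E !sum_ord4 !mxE /=; split; ring.
by apply: ord4_cases => //; apply: ord4_cases => //= _ _; rewrite !T'E !sum_ord4 !mxE /=; ring.
Qed.

Lemma biquadric_frame_change p q r s T w x y z : T^T = T ->
  biquadric (gram (frame_change p q r s) T) w x y z = biquadric T (p * w + r * x) (q * w + s * x) y z.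
Proof.
move=> /(gram_frame_changeE p q r s) /= [e00 e01 e11 ej eij].
have [e02 e12] := ej 2 isT; have [e03 e13] := ej 3 isT.
by rewrite /biquadric e00 e01 e11 e02 e12 e03 e13 !eij //; ring.
Qed.

Lemma biquadric_grad_frame_change p q r s T w x y z : T^T = T ->
  let T' := gram (frame_change p q r s) T in
  let g i := biquadric_grad T i (p * w + r * x) (q * w + s * x) y z in
  [/\ biquadric_grad T' 0 w x y z = p * g 0 + q * g 1,
      biquadric_grad T' 1 w x y z = r * g 0 + s * g 1,
      biquadric_grad T' 2 w x y z = g 2 & biquadric_grad T' 3 w x y z = g 3].
Proof.
move=> /(gram_frame_changeE p q r s) /= [e00 e01 e11 ej eij].
have [e02 e12] := ej 2 isT; have [e03 e13] := ej 3 isT.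
by split; rewrite /biquadric_grad e00 e01 e11 e02 e12 e03 e13 !eij //=; ring.
Qed.

Lemma biquadric_euler T w x y z :
  w * biquadric_grad T 0 w x y z + x * biquadric_grad T 1 w x y z = 2 * biquadric T w x y z /\
  y * biquadric_grad T 2 w x y z + z * biquadric_grad T 3 w x y z = 2 * biquadric T w x y z.
Proof. by split; rewrite /biquadric_grad /biquadric /=; ring. Qed.

Lemma tangencyE T t y z :
  (tangency0 T).[t] * y ^+ 2 + (tangency1 T).[t] * (y * z) + (tangency2 T).[t] * z ^+ 2 =
  biquadric T t 1 y z.
Proof.
rewrite /tangency0 /tangency1 /tangency2 /chart_u /chart_m /biquadric.
rewrite !(hornerD, hornerN, hornerZ, horner_exp, hornerM, hornerX, hornerC); ring.
Qed.

Lemma tangency_grad T t y z :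
  [/\ 2 * (tangency0 T).[t] * y + (tangency1 T).[t] * z = biquadric_grad T 2 t 1 y z,
      (tangency1 T).[t] * y + 2 * (tangency2 T).[t] * z = biquadric_grad T 3 t 1 y z &
      (tangency0 T)^`().[t] * y ^+ 2 + (tangency1 T)^`().[t] * (y * z) +
        (tangency2 T)^`().[t] * z ^+ 2 = biquadric_grad T 0 t 1 y z].
Proof.
split; rewrite /tangency0 /tangency1 /tangency2 /chart_u /chart_m /biquadric_grad /= ?expr2
  ?(derivB, derivD, derivZ, derivM, derivX, derivC)
  !(hornerD, hornerN, hornerZ, horner_exp, hornerM, hornerX, hornerC); ring.
Qed.

(** The curve has no singular point above the chart [t, 1]: where the
    derivatives of the form in y and z vanish, its derivative in t does not. *)
Definition chart_smooth T := forall t y z : K, (y != 0) || (z != 0) ->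
  2 * (tangency0 T).[t] * y + (tangency1 T).[t] * z = 0 ->
  (tangency1 T).[t] * y + 2 * (tangency2 T).[t] * z = 0 ->
  (tangency0 T)^`().[t] * y ^+ 2 + (tangency1 T)^`().[t] * (y * z) +
    (tangency2 T)^`().[t] * z ^+ 2 != 0.

(** Euler relations in each pair of variables turn the vanishing of the
    derivatives in t, y and z into the vanishing of the form and of all four
    partial derivatives. *)
Lemma smooth22_chart (a b c d : 'rV[K]_4) (Q : quadric K) p q r s :
  p * s - q * r != 0 -> smooth22 (form22 a b c d Q) ->
  chart_smooth (gram (basis (p *: a + q *: b) (r *: a + s *: b) c d) (quadric_mx Q)).
Proof.
move=> det0 smoothF t y z yz0; rewrite frame_changeE gram_mul.
set T := gram (basis a b c d) _; have symT : T^T = T by exact/gram_sym/quadric_mx_sym.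
have [-> -> ->] := tangency_grad (gram (frame_change p q r s) T) t y z => g2 g3.
apply/eqP => g0.
have [eu ev] := biquadric_euler (gram (frame_change p q r s) T) t 1 y z.
have F0 : biquadric (gram (frame_change p q r s) T) t 1 y z = 0.
  by apply: (mulfI (two_neq0 K)); rewrite -ev g2 g3; ring.
have g1 : biquadric_grad (gram (frame_change p q r s) T) 1 t 1 y z = 0.
  by move: eu; rewrite g0 F0 !mulr0 add0r mul1r.
move: F0 g0 g1 g2 g3; rewrite biquadric_frame_change //.
have [-> -> -> ->] := biquadric_grad_frame_change p q r s t 1 y z symT.
set w := p * t + r * 1; set x := q * t + s * 1 => F0 e0 e1 g2 g3.
have cramer (u v : K) : p * u + q * v = 0 -> r * u + s * v = 0 -> u = 0 /\ v = 0.
  move=> euv euv'; split; apply: (mulfI det0); rewrite mulr0.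
    by transitivity (s * (p * u + q * v) - q * (r * u + s * v)); [ring | rewrite euv euv'; ring].
  by transitivity (p * (r * u + s * v) - r * (p * u + q * v)); [ring | rewrite euv euv'; ring].
have [g0 g1] := cramer _ _ e0 e1.
pose v (i : 'I_4) := nth 0 [:: w; x; y; z] i.
have vF : (form22 a b c d Q).@[v] = 0 by rewrite form22_eval.
have wx0 : (v 0 != 0) || (v 1 != 0).
  rewrite -negb_and /v /=; apply: contra det0 => /andP[/eqP w0 /eqP x0].
  have rE : r = - (p * t) by apply/eqP; rewrite -subr_eq0 opprK -[X in _ == X]w0; apply/eqP; rewrite /w; ring.
  have sE : s = - (q * t) by apply/eqP; rewrite -subr_eq0 opprK -[X in _ == X]x0; apply/eqP; rewrite /x; ring.
  by rewrite rE sE; apply/eqP; ring.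
case: (smoothF v wx0 yz0 vF) => i; rewrite form22_grad => /eqP; apply.
by move: i; apply: ord4_cases.
Qed.

End ChangeOfBasis.

Section GoodBasis.
Variable K : numClosedFieldType.
Implicit Types (T : 'M[K]_4).

Definition tangency_discriminant T : {poly K} :=
  tangency1 T ^+ 2 - 4 *: (tangency0 T * tangency2 T).

Lemma top_coef_mul (p q : {poly K}) : (size p <= 3)%N -> (size q <= 3)%N ->
  (size (p * q)%R <= 5)%N /\ (p * q)`_4 = p`_2 * q`_2.
Proof.
move=> sp sq; split.
  by apply: leq_trans (size_polyMleq _ _) _; rewrite -subn1 leq_subLR (leq_add sp sq).
have high (f : {poly K}) i : (size f <= 3)%N -> (2 < i)%N -> f`_i = 0.
  by move=> sf lti; rewrite nth_default // (leq_trans sf).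
rewrite coefM !big_ord_recl big_ord0 /= /bump /=.
by rewrite (high q 4) ?(high q 3) ?(high p 3) ?(high p 4) // !(mulr0, mul0r, add0r, addr0).
Qed.

Lemma discriminant_top_coef T :
  (size (tangency_discriminant T) <= 5)%N /\
  (tangency_discriminant T)`_4 =
    (tangency1 T)`_2 ^+ 2 - 4 * ((tangency0 T)`_2 * (tangency2 T)`_2).
Proof.
have [s0 s1 s2] := size_tangency T.
have [s11 c11] := top_coef_mul s1 s1; have [s02 c02] := top_coef_mul s0 s2.
split; last by rewrite coefB coefZ expr2 c11 c02.
rewrite (leq_trans (size_polyD _ _)) // geq_max expr2 s11 size_polyN.
exact: leq_trans (size_scale_leq _ _) s02.
Qed.

Lemma tangency_top_coef T :
  [/\ (tangency0 T)`_2 = T 2 2 * T 0 0 - T 0 2 ^+ 2,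
      (tangency1 T)`_2 = 2 * (T 2 3 * T 0 0 - T 0 2 * T 0 3) &
      (tangency2 T)`_2 = T 3 3 * T 0 0 - T 0 3 ^+ 2].
Proof.
have [_ _ u2] := coef_chart_u T.
have m2 i j : (chart_m T i * chart_m T j)`_2 = T 0 i * T 0 j.
  have [i0 i1] := coef_chart_m T i; have [j0 j1] := coef_chart_m T j.
  rewrite coefM !big_ord_recl big_ord0 /= /bump /= i1 j1.
  by rewrite !(nth_default _ (size_chart_m _ _)) !(mulr0, mul0r, add0r, addr0).
by split; rewrite coefB !coefZ ?expr2 m2 u2; ring.
Qed.

(** The discriminant is a nonzero polynomial by smoothness; sending a point t0
    that is not a root of it to infinity makes it of degree 4. *)
Lemma exists_good_basis (a b c d : 'rV[K]_4) (Q : quadric K) :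
  smooth22 (form22 a b c d Q) -> exists p q r s, p * s - q * r != 0 /\
  size (tangency_discriminant
    (gram (basis (p *: a + q *: b) (r *: a + s *: b) c d) (quadric_mx Q))) = 5%N.
Proof.
move=> smoothF; set T := gram (basis a b c d) (quadric_mx Q).
have symT : T^T = T by exact/gram_sym/quadric_mx_sym.
have chartT : chart_smooth T.
  have := @smooth22_chart _ a b c d Q 1 0 0 1 _ smoothF.
  rewrite !scale1r !scale0r addr0 add0r; apply.
  by rewrite mulr1 mulr0 subr0 oner_eq0.
have /roots_seq[rs Drs] : tangency_discriminant T != 0.
  apply/eqP => D0; have := @smooth_discriminant_simple _ _ _ _ chartT 0.
  by rewrite -/(tangency_discriminant T) D0 deriv0 !root0 => /(_ isT).
have [t0 t0D] := exists_notin rs; exists t0, 1, 1, 0; split.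
  by rewrite mulr0 mul1r sub0r oppr_eq0 oner_eq0.
rewrite frame_changeE gram_mul -/T; set T' := gram _ T.
have [sD D4] := discriminant_top_coef T'.
apply/eqP; rewrite eqn_leq sD ltnNge; apply/negP => sD4.
have := D4; rewrite nth_default //; have [-> -> ->] := tangency_top_coef T'.
have /= [e00 _ _ ej eij] := gram_frame_changeE t0 1 1 0 symT.
have [e02 _] := ej 2 isT; have [e03 _] := ej 3 isT.
rewrite /T' e00 e02 e03 !eij // => D0.
case/negP: t0D; apply: Drs; rewrite rootE; apply/eqP; rewrite [RHS]D0.
rewrite /tangency_discriminant /tangency0 /tangency1 /tangency2 /chart_u /chart_m.
rewrite !(hornerD, hornerN, hornerZ, horner_exp, hornerM, hornerX, hornerC); ring.
Qed.

End GoodBasis.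

(** * Conics of quadrics *)

Section GramCoordinates.
Variables (K : numClosedFieldType) (P : 'M[K]_4).
Hypothesis Punit : P \in unitmx.

Lemma gram_sym_mx_sum (q0 q1 q2 : 'rV[K]_10) x y z :
  gram P (sym_mx (x *: q0 + y *: q1 + z *: q2)) =
  x *: gram P (sym_mx q0) + y *: gram P (sym_mx q1) + z *: gram P (sym_mx q2).
Proof.
have -> : sym_mx (x *: q0 + y *: q1 + z *: q2) = x *: sym_mx q0 + y *: sym_mx q1 + z *: sym_mx q2.
  by apply/matrixP => i j; rewrite !mxE.
by rewrite /gram !mulmxDr !mulmxDl -!scalemxAr -!scalemxAl.
Qed.

Lemma gram_sym_mx_inj : injective (fun q => gram P (sym_mx q)).
Proof.
have PTunit : P^T \in unitmx by rewrite unitmx_tr.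
move=> q q' /(can_inj (mulmxK PTunit))/(can_inj (mulKmx Punit)).
exact: sym_mx_inj.
Qed.

Lemma gram_sym_mxZ c q : gram P (sym_mx (c *: q)) = c *: gram P (sym_mx q).
Proof. by have := gram_sym_mx_sum q 0 0 c 0 0; rewrite !scale0r !addr0. Qed.

Lemma gram_sym_mx_surj (N : 'M[K]_4) : N^T = N -> exists q, gram P (sym_mx q) = N.
Proof.
move=> symN; pose M := gram (invmx P) N.
have /sym_mxP[q ME] : M^T = M by exact: gram_sym.
exists q; rewrite -ME /M -gram_mul /gram mulmxV // mul1mx trmx1 mulmx1 //.
Qed.

(** The three blocks of N, as quadrics, span the plane of the conic; they are
    nonzero and occupy disjoint entries, hence are independent. *)
Lemma torus_conic (N : 'M[K]_4) : N^T = N ->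
  torus 1 0 0 N != 0 -> torus 0 1 0 N != 0 -> torus 0 0 1 N != 0 ->
  exists2 E : 'M[K]_(3, 10), row_free E &
    forall s t, gram P (sym_mx (conic_vec E s t)) = torus (s ^+ 2) (s * t) (t ^+ 2) N.
Proof.
move=> symN Nu Nm Nv.
have [q0 q0E] := gram_sym_mx_surj (torus_sym 1 0 0 symN).
have [q1 q1E] := gram_sym_mx_surj (torus_sym 0 1 0 symN).
have [q2 q2E] := gram_sym_mx_surj (torus_sym 0 0 1 symN).
pose E : 'M[K]_(3, 10) := \matrix_(i < 3) nth 0 [:: q0; q1; q2] i.
have [E0 E1 E2] : [/\ row 0 E = q0, row 1 E = q1 & row 2 E = q2] by rewrite !rowK.
clearbody E; exists E; last by move=> s t; rewrite conic_vecE E0 E1 E2 gram_sym_mx_sum q0E q1E q2E -torus_linear.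
apply: inj_row_free => v vE0.
have vEE : v *m E = v 0 0 *: q0 + v 0 1 *: q1 + v 0 2 *: q2.
  rewrite mulmx_sum_row !big_ord_recl big_ord0 addr0 addrA.
  rewrite -E0 -E1 -E2; congr (_ + _ + _); [rewrite (_ : lift ord0 ord0 = 1) | rewrite (_ : lift ord0 (lift ord0 ord0) = 2)];
    by rewrite //; apply: val_inj.
have vT : torus (v 0 0) (v 0 1) (v 0 2) N = 0.
  rewrite torus_linear -q0E -q1E -q2E -gram_sym_mx_sum -vEE vE0.
  by have := gram_sym_mxZ 0 0; rewrite !scale0r.
have part x y z x' y' z' : torus x' y' z' N = 0 -> torus (x * x') (y * y') (z * z') N = 0.
  move=> T0; apply/matrixP => i j; have := congr1 (fun M : 'M_4 => M i j) T0; rewrite !mxE.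
  by do 2!case: ifP => _; move=> M0; rewrite -mulrA M0 mulr0.
have zero x (A : 'M[K]_4) : x *: A = 0 -> A != 0 -> x = 0.
  by move=> /eqP; rewrite scaler_eq0 => /orP[/eqP //|->].
have v0 : v 0 0 = 0.
  apply: (zero _ _ _ Nu); have := part 1 0 0 _ _ _ vT.
  by rewrite torus_linear !mul1r !mul0r !scale0r !addr0.
have v1 : v 0 1 = 0.
  apply: (zero _ _ _ Nm); have := part 0 1 0 _ _ _ vT.
  by rewrite torus_linear !mul1r !mul0r !scale0r add0r addr0.
have v2 : v 0 2 = 0.
  apply: (zero _ _ _ Nv); have := part 0 0 1 _ _ _ vT.
  by rewrite torus_linear !mul1r !mul0r !scale0r !add0r.
apply/rowP => -[[|[|[|//]]] lt_i]; rewrite mxE.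
- by rewrite -[RHS]v0; congr (v 0 _); apply: val_inj.
- by rewrite -[RHS]v1; congr (v 0 _); apply: val_inj.
- by rewrite -[RHS]v2; congr (v 0 _); apply: val_inj.
Qed.

End GramCoordinates.

(** * Transversal lines and tangency *)

Lemma bilinear_left (A : comNzRingType) (M : 'M[A]_4) (u v f : 'rV[A]_4) i j :
  ((i *: u + j *: v) *m M *m f^T) 0 0 = i * (u *m M *m f^T) 0 0 + j * (v *m M *m f^T) 0 0.
Proof.
rewrite !mulmxDl -!scalemxAl.
by move: (u *m M *m _) (v *m M *m _) => U V; rewrite !mxE.
Qed.

Section TransversalLines.
Variables (K : numClosedFieldType) (l1 l2 : line K 3) (a b c d : 'rV[K]_4).
Hypotheses (hskew : skew_lines l1 l2).
Hypotheses (hl1 : val l1 = <<[:: a; b]>>%VS) (hl2 : val l2 = <<[:: c; d]>>%VS).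
Implicit Types (l : line K 3) (Q : quadric K).

Lemma mem_span2 (u v w : 'rV[K]_4) :
  u \in <<[:: v; w]>>%VS -> exists x y, u = x *: v + y *: w.
Proof.
rewrite span_cons span_seq1 => /memv_addP[_ /vlineP[x ->] [_ /vlineP[y ->] ->]].
by exists x, y.
Qed.

Lemma span2_mem (v w : 'rV[K]_4) x y : x *: v + y *: w \in <<[:: v; w]>>%VS.
Proof. by rewrite rpredD ?rpredZ // memv_span ?inE ?eqxx ?orbT. Qed.

Lemma line_free l (u v : 'rV[K]_4) x y : val l = <<[:: u; v]>>%VS ->
  x *: u + y *: v = 0 -> x = 0 /\ y = 0.
Proof.
move=> lE; have : free [:: u; v] by rewrite /free -lE (eqP (valP l)).
rewrite free_cons seq1_free span_seq1 => /andP[uv v0] xy0.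
have x0 : x = 0.
  apply/eqP; apply: contraNT uv => x0; apply/vlineP; exists (- (y / x)).
  apply: (scalerI x0); rewrite scalerA mulrN mulrCA divff // mulr1 scaleNr.
  by apply/eqP; rewrite -subr_eq0 opprK xy0.
split=> //; move: xy0; rewrite x0 scale0r add0r => /eqP.
by rewrite scaler_eq0 (negPf v0) orbF => /eqP.
Qed.

Lemma frame_independent w x y z : w *: a + x *: b + (y *: c + z *: d) = 0 ->
  [/\ w = 0, x = 0, y = 0 & z = 0].
Proof.
move=> wxyz.
have : w *: a + x *: b \in (val l1 :&: val l2)%VS.
  rewrite memv_cap hl1 span2_mem hl2 -(addrK (y *: c + z *: d) (w *: a + _)) wxyz sub0r.
  by rewrite rpredN span2_mem.
rewrite hskew memv0 => /eqP wx; move: wxyz; rewrite wx add0r => yz.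
have [-> ->] := line_free hl1 wx; have [-> ->] := line_free hl2 yz.
by split.
Qed.

Lemma basis_unit : basis a b c d \in unitmx.
Proof.
rewrite -row_free_unit; apply: inj_row_free => v.
rewrite mulmx_sum_row sum_ord4 !rowK /= -addrA => /frame_independent[v0 v1 v2 v3].
by apply/rowP; apply: ord4_cases; rewrite mxE.
Qed.

Let param_u w x := w *: a + x *: b.
Let param_v y z := y *: c + z *: d.

Lemma param_u0 w x : (param_u w x != 0) = (w != 0) || (x != 0).
Proof.
apply/idP/idP; first by apply: contraNT; rewrite negb_or !negbK => /andP[/eqP -> /eqP ->]; rewrite /param_u !scale0r addr0.
by apply: contraTneq => /(line_free hl1)[-> ->]; rewrite eqxx.
Qed.

Lemma param_v0 y z : (param_v y z != 0) = (y != 0) || (z != 0).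
Proof.
apply/idP/idP; first by apply: contraNT; rewrite negb_or !negbK => /andP[/eqP -> /eqP ->]; rewrite /param_v !scale0r addr0.
by apply: contraTneq => /(line_free hl2)[-> ->]; rewrite eqxx.
Qed.

Lemma dim_transversal w x y z : param_u w x != 0 -> param_v y z != 0 ->
  \dim <<[:: param_u w x; param_v y z]>>%VS == 2%N.
Proof.
move=> u0 v0; suff /eqP -> : free [:: param_u w x; param_v y z] by [].
rewrite free_cons seq1_free span_seq1 v0 andbT; apply/vlineP => -[k uE].
have : param_u w x + param_v (- k * y) (- k * z) = 0.
  by rewrite uE /param_v -!scalerA -scalerDr scaleNr subrr.
move=> /frame_independent[w0 x0 _ _].
by move: u0; rewrite param_u0 w0 x0 eqxx.
Qed.

Lemma transversal_param l : transversal_line l l1 -> transversal_line l l2 ->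
  exists w x y z, [/\ param_u w x != 0, param_v y z != 0 &
    val l = <<[:: param_u w x; param_v y z]>>%VS].
Proof.
move=> /eqP ll1 /eqP ll2.
have := memv_pick (val l :&: val l1); set u := vpick _; rewrite memv_cap => /andP[lu].
have : u != 0 by rewrite vpick0.
rewrite hl1 => + /mem_span2[w [x uE]]; rewrite uE in lu * => u0.
have := memv_pick (val l :&: val l2); set v := vpick _; rewrite memv_cap => /andP[lv].
have : v != 0 by rewrite vpick0.
rewrite hl2 => + /mem_span2[y [z vE]]; rewrite vE in lv * => v0.
exists w, x, y, z; split=> //; apply/esym/eqP; rewrite eqEdim (eqP (valP l)).
rewrite (eqP (dim_transversal u0 v0)) leqnn andbT.
by apply/span_subvP => e; rewrite !inE => /orP[] /eqP ->.
Qed.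

Lemma param_transversal w x y z : param_u w x != 0 -> param_v y z != 0 ->
  exists l, [/\ transversal_line l l1, transversal_line l l2 &
    val l = <<[:: param_u w x; param_v y z]>>%VS].
Proof.
move=> u0 v0; exists (exist (fun V : {vspace 'rV[K]_4} => \dim V == 2%N) _ (dim_transversal u0 v0)); split=> //=.
  move=> /vspaceP/(_ (param_u w x)); rewrite memv_cap hl1 span2_mem memv_span ?mem_head //.
  by rewrite memv0 (negPf u0).
move=> /vspaceP/(_ (param_v y z)); rewrite memv_cap hl2 span2_mem memv_span ?inE ?eqxx ?orbT //.
by rewrite memv0 (negPf v0).
Qed.

(** A quadratic form on a plane is singular iff its Gram determinant in a basis
    is zero. *)
Lemma tangent_param l Q w x y z : val l = <<[:: param_u w x; param_v y z]>>%VS ->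
  tangent l Q <-> biquadric (gram (basis a b c d) (quadric_mx Q)) w x y z = 0.
Proof.
move=> lE; rewrite -biquadric_bilinear; last exact: quadric_mx_sym.
rewrite -/(param_u w x) -/(param_v y z) /=.
move: (param_u w x) (param_v y z) lE => u v lE.
have rad0 := bilinear_left (quadric_mx Q) u v.
have swap : (v *m quadric_mx Q *m u^T) 0 0 = (u *m quadric_mx Q *m v^T) 0 0.
  have -> : v *m quadric_mx Q *m u^T = (u *m quadric_mx Q *m v^T)^T.
    by rewrite !trmx_mul trmxK quadric_mx_sym mulmxA.
  by move: (u *m _ *m _) => A; rewrite mxE.
have lu : u \in val l by rewrite lE memv_span ?mem_head.
have lv : v \in val l by rewrite lE memv_span ?inE ?eqxx ?orbT.
have mx1 (A : 'M[K]_1) : A = 0 <-> A 0 0 = 0.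
  by split=> [->|A0]; [rewrite mxE | apply/rowP => k; rewrite !ord1 A0 mxE].
have lr (f e : 'rV[K]_4) : (e *m quadric_mx Q *m u^T) 0 0 = 0 -> (e *m quadric_mx Q *m v^T) 0 0 = 0 ->
    f \in val l -> e *m quadric_mx Q *m f^T = 0.
  move=> /mx1 eu /mx1 ev; rewrite lE => /mem_span2[i [j ->]].
  by rewrite !linearD !linearZ /= eu ev !scaler0 addr0.
rewrite swap; move: rad0 swap.
pose B (e f : 'rV[K]_4) : K := (e *m quadric_mx Q *m f^T) 0 0; rewrite -/(B u u) -/(B v v) -/(B u v).
move=> rad0 swap; have BE i j f : B (i *: u + j *: v) f = i * B u f + j * B v f := rad0 f i j.
have {}swap : B v u = B u v := swap.
split=> [[e le [e0 rad]]|det0].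
  move: le e0 rad; rewrite lE => /mem_span2[i [j ->]] ij0 rad.
  have radu : i * B u u + j * B u v = 0 by rewrite -swap -BE; apply/mx1/rad; rewrite -lE.
  have radv : i * B u v + j * B v v = 0 by rewrite -BE; apply/mx1/rad; rewrite -lE.
  have idet : i * (B u u * B v v - B u v * B u v) = 0.
    transitivity ((i * B u u + j * B u v) * B v v - (i * B u v + j * B v v) * B u v); first by ring.
    by rewrite radu radv !mul0r subrr.
  have jdet : j * (B u u * B v v - B u v * B u v) = 0.
    transitivity ((i * B u v + j * B v v) * B u u - (i * B u u + j * B u v) * B u v); first by ring.
    by rewrite radu radv !mul0r subrr.
  apply/eqP; apply: contraNT ij0 => det0.
  have i0 : i = 0 by apply: (mulIf det0); rewrite mul0r.
  have j0 : j = 0 by apply: (mulIf det0); rewrite mul0r.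
  by rewrite i0 j0 !scale0r addr0.
have null i j : (i, j) != (0, 0) -> i * B u u + j * B u v = 0 -> i * B u v + j * B v v = 0 -> tangent l Q.
  move=> ij0 radu radv; exists (i *: u + j *: v); first by rewrite lE span2_mem.
  split; first by apply: contra_neq ij0 => /(line_free lE)[-> ->].
  by move=> f; apply: lr; rewrite -/(B _ _) BE ?swap.
have [uu0|uu0] := eqVneq (B u u) 0.
  have uv0 : B u v = 0 by apply/eqP; rewrite -sqrf_eq0 expr2 -oppr_eq0 -det0 uu0 mul0r add0r.
  by apply: (null 1 0); rewrite ?xpair_eqE ?oner_eq0 // ?uu0 ?uv0; ring.
(* A kernel vector of the singular Gram matrix, read off its first row. *)
apply: (null (- B u v) (B u u)); first by rewrite xpair_eqE negb_and uu0 orbT.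
  by ring.
by rewrite -det0; ring.
Qed.

End TransversalLines.

Section CommonTangents.
Variables (K : numClosedFieldType) (l1 l2 : line K 3) (a b c d : 'rV[K]_4).
Hypotheses (hskew : skew_lines l1 l2).
Hypotheses (hl1 : val l1 = <<[:: a; b]>>%VS) (hl2 : val l2 = <<[:: c; d]>>%VS).
Variable Q : quadric K.
Implicit Types (l : line K 3).

Let T (Q' : quadric K) := gram (basis a b c d) (quadric_mx Q').
Let common (Q' : quadric K) : set (line K 3) :=
  [set l | [/\ transversal_line l l1, transversal_line l l2, tangent l Q & tangent l Q']].

Let pu w x := w *: a + x *: b.
Let pv y z := y *: c + z *: d.

Hypothesis sD : size (tangency_discriminant (T Q)) = 5%N.
Hypothesis smoothQ : chart_smooth (T Q).

(** Above each t the form of Q has a zero, which is a common tangent, and lines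
    through distinct points of l1 are distinct. *)
Lemma proportional_common_infinite lam Q' :
  tangency_scaled lam (T Q) (T Q') -> infinite_set (common Q').
Proof.
move=> [e0 e1 e2].
have /choice[L LP] t : exists l, common Q' l /\ exists y z,
    val l = <<[:: pu t 1; pv y z]>>%VS.
  have [y [z [yz0 Fyz]]] := binary_quadratic_zero
    (tangency0 (T Q)).[t] (tangency1 (T Q)).[t] (tangency2 (T Q)).[t].
  have u0 : pu t 1 != 0 by rewrite (param_u0 hl1) oner_eq0 orbT.
  have v0 : pv y z != 0 by rewrite (param_v0 hl2).
  have [l [ll1 ll2 lE]] := param_transversal hskew hl1 hl2 u0 v0.
  exists l; split; last by exists y, z.
  have tp q : tangent l q <-> biquadric (T q) t 1 y z = 0 := tangent_param q lE.
  split=> //; apply/tp; rewrite -tangencyE -/(T _) //.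
  rewrite e0 e1 e2 !hornerZ; transitivity (lam * 0); last by rewrite mulr0.
  by rewrite -Fyz; ring.
apply: (@sub_infinite_set _ (range L)); first by move=> _ [t _ <-]; case: (LP t).
apply: infinite_range (@infinite_field K) => s t _ _ eqL.
have [_ [y [z sE]]] := LP s; have [_ [y' [z' tE]]] := LP t.
have : pu s 1 \in <<[:: pu t 1; pv y' z']>>%VS.
  by rewrite -tE -eqL sE memv_span ?mem_head.
move=> /mem_span2[i [j E]].
have : (s - i * t) *: a + (1 - i) *: b + ((- j * y') *: c + (- j * z') *: d) = 0.
  apply/eqP; rewrite -(subrr (pu s 1)) [in X in _ == _ - X]E.
  by apply/eqP/rowP => k; rewrite /pu /pv !mxE; ring.
move=> /(frame_independent hskew hl1 hl2)[/eqP + /eqP + _ _].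
by rewrite !subr_eq0 => /eqP -> /eqP <-; rewrite mul1r.
Qed.

Lemma finite_lines (s : seq {vspace 'rV[K]_4}) : finite_set [set l : line K 3 | val l \in s].
Proof.
apply: contrapT => inf; apply: (infinite_range (f := val) _ inf).
  by move=> l l' _ _; exact: val_inj.
by apply: sub_finite_set (finite_seq s) => _ [l ls <-].
Qed.

(** If the resultant of the two forms is not identically zero, the common
    tangents pass through finitely many points of l1, and above each of these
    points the form of Q, which is not zero there, has finitely many zeros. *)
Lemma infinite_common_proportional Q' : infinite_set (common Q') ->
  exists k, tangency_scaled k (T Q) (T Q').
Proof.
move=> inf; have [s0' s1' s2'] := size_tangency (T Q').
have cop := smooth_coprime smoothQ.
pose R := quadratic_resultant (tangency0 (T Q)) (tangency1 (T Q)) (tangency2 (T Q))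
  (tangency0 (T Q')) (tangency1 (T Q')) (tangency2 (T Q')).
have [R0|/roots_seq[rs Rrs]] := eqVneq R 0.
  have [k kE] := common_component sD cop (smooth_discriminant_simple smoothQ) s0' s1' s2' R0.
  by exists k.
case: inf.
have line_scale k (v : 'rV[K]_4) : k != 0 -> <[k *: v]>%VS = <[v]>%VS.
  move=> k0; apply/eqP; rewrite eqEsubv -!memvE rpredZ ?memv_line //.
  by rewrite -{1}(scalerK k0 v) rpredZ ?memv_line.
pose through (wx : K * K) := pu wx.1 wx.2.
(* The points of l1 through which a common tangent may pass: the roots of R, and
   the point at infinity of the chart. *)
pose wxs : seq (K * K) := (1, 0) :: [seq (t, 1) | t <- rs].
have biquadricZ (N : 'M[K]_4) k w x y z : biquadric N (k * w) (k * x) y z = k ^+ 2 * biquadric N w x y z.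
  by rewrite /biquadric; ring.
have fibre A B C wx : (A, B, C) != (0, 0, 0) ->
    (forall y z, biquadric (T Q) wx.1 wx.2 y z = A * y ^+ 2 + B * (y * z) + C * z ^+ 2) ->
    exists vs : seq 'rV[K]_4, forall y z, (y != 0) || (z != 0) ->
    biquadric (T Q) wx.1 wx.2 y z = 0 ->
    exists2 v, v \in vs & <[pv y z]>%VS = <[v]>%VS.
  move=> /binary_quadratic_roots[r rP] FE; exists (c :: [seq y *: c + d | y <- r]) => y z yz0.
  rewrite FE => Fyz; have [z0|z0] := eqVneq z 0.
    exists c; first exact: mem_head.
    by rewrite /pv z0 scale0r addr0 line_scale //; move: yz0; rewrite z0 eqxx orbF.
  exists ((y / z) *: c + d).
    by rewrite inE; apply/orP; right; apply: (map_f (fun t => t *: c + d)); exact: rP.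
  by rewrite /pv -(line_scale z ((y / z) *: c + d)) // scalerDr scalerA mulrC divfK.
have /choice[vs vsP] wx : exists vs : seq 'rV[K]_4, wx \in wxs -> forall y z,
    (y != 0) || (z != 0) -> biquadric (T Q) wx.1 wx.2 y z = 0 ->
    exists2 v, v \in vs & <[pv y z]>%VS = <[v]>%VS.
  have [|notin] := boolP (wx \in wxs); last by exists [::].
  rewrite inE => /orP[/eqP ->|/mapP[t _ ->]].
    have [m0 m1 m2] := tangency_top_coef (T Q).
    have [||vs vsP] := @fibre (tangency0 (T Q))`_2 (tangency1 (T Q))`_2 (tangency2 (T Q))`_2 (1, 0).
    - apply/eqP => -[t0 t1 t2]; have [_ D4] := discriminant_top_coef (T Q).
      have : lead_coef (tangency_discriminant (T Q)) == 0.
        by rewrite lead_coefE sD /= D4 t0 t1 t2 mul0r mulr0 subr0 expr0n.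
      by rewrite lead_coef_eq0 -size_poly_eq0 sD.
    - by move=> y z; rewrite m0 m1 m2 /biquadric /=; ring.
    - by exists vs.
  have [||vs vsP] := @fibre (tangency0 (T Q)).[t] (tangency1 (T Q)).[t] (tangency2 (T Q)).[t] (t, 1).
  - by apply: contra (cop t) => /eqP[t0 t1 t2]; rewrite !rootE t0 t1 t2 eqxx.
  - by move=> y z; rewrite tangencyE.
  - by exists vs.
apply: sub_finite_set (finite_lines [seq <<[:: through wx; v]>>%VS | wx <- wxs, v <- vs wx]).
move=> l [ll1 ll2 lQ lQ'] /=.
have [w [x [y [z [u0 v0 lE]]]]] := transversal_param hskew hl1 hl2 ll1 ll2.
have FQ : biquadric (T Q) w x y z = 0 by move: lQ => /(tangent_param Q lE).
have FQ' : biquadric (T Q') w x y z = 0 by move: lQ' => /(tangent_param Q' lE).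
have yz0 : (y != 0) || (z != 0) by rewrite -(param_v0 hl2).
have [wx [k [wx_in k0 wE xE]]] : exists wx k, [/\ wx \in wxs, k != 0, w = k * wx.1 & x = k * wx.2].
  have [x0|x0] := eqVneq x 0.
    exists (1, 0), w; split; rewrite ?mem_head /= ?mulr1 ?mulr0 //.
    by move: u0; rewrite (param_u0 hl1) x0 eqxx orbF.
  exists (w / x, 1), x; split; rewrite //= ?mulr1 //; last by rewrite mulrC divfK.
  rewrite inE; apply/orP; right; apply: map_f; apply: Rrs.
  have at_ratio N : biquadric N w x y z = 0 -> biquadric N (w / x) 1 y z = 0.
    move=> Nwx; apply: (mulfI (expf_neq0 2 x0)); rewrite -biquadricZ mulr1 mulr0.
    by rewrite [x * _]mulrC divfK.
  by apply: (resultant_common_root yz0); rewrite tangencyE at_ratio.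
have Fwx : biquadric (T Q) wx.1 wx.2 y z = 0.
  by apply: (mulfI (expf_neq0 2 k0)); rewrite -biquadricZ -wE -xE mulr0.
have [v v_in vE] := vsP wx wx_in y z yz0 Fwx.
have -> : val l = <<[:: through wx; v]>>%VS; last exact: allpairs_f_dep wx_in v_in.
rewrite lE !span_cons !span_nil !addv0 vE; congr (_ + _)%VS.
by rewrite -(line_scale k (through wx)) // wE xE /through /pu scalerDr !scalerA.
Qed.

End CommonTangents.

(** * The twelve conics *)

Section Vanishing.
Variable K : numClosedFieldType.
Implicit Types N : 'M[K]_4.

Lemma tangency_eq0P N :
  [/\ tangency0 N = 0, tangency1 N = 0 & tangency2 N = 0] <->
  (forall w x y z, biquadric N w x y z = 0).
Proof.
split=> [[t0 t1 t2] w x y z|F0].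
  have [x0|x0] := eqVneq x 0.
    have [] := tangency_top_coef N; rewrite t0 t1 t2 !coef0 => m0 m1 m2.
    transitivity (w ^+ 2 * ((N 2 2 * N 0 0 - N 0 2 ^+ 2) * y ^+ 2 +
      2 * (N 2 3 * N 0 0 - N 0 2 * N 0 3) * (y * z) + (N 3 3 * N 0 0 - N 0 3 ^+ 2) * z ^+ 2)).
      by rewrite x0 /biquadric; ring.
    by rewrite -m0 -m1 -m2; ring.
  transitivity (x ^+ 2 * biquadric N (w / x) 1 y z); first by rewrite /biquadric; field.
  by rewrite -tangencyE t0 t1 t2 !horner0; ring.
have at_t t y z := etrans (tangencyE N t y z) (F0 t 1 y z).
have t0 : tangency0 N = 0.
  by apply: (@poly_eq0_cofinite _ _ [::]) => t _; rewrite -(at_t t 1 0); ring.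
have t2 : tangency2 N = 0.
  by apply: (@poly_eq0_cofinite _ _ [::]) => t _; rewrite -(at_t t 0 1); ring.
split=> //; apply: (@poly_eq0_cofinite _ _ [::]) => t _.
by have := at_t t 1 1; rewrite t0 t2 !horner0 => <-; ring.
Qed.

Lemma biquadric_frame_change_eq0 p q r s N : p * s - q * r != 0 -> N^T = N ->
  (forall w x y z, biquadric (gram (frame_change p q r s) N) w x y z = 0) <->
  (forall w x y z, biquadric N w x y z = 0).
Proof.
move=> det0 symN; split=> F0 w x y z; last by rewrite biquadric_frame_change.
have := F0 ((s * w - r * x) / (p * s - q * r)) ((p * x - q * w) / (p * s - q * r)) y z.
rewrite biquadric_frame_change // => <-; congr (biquadric _ _ _ _ _); field; exact: det0.
Qed.

Lemma torus_torus x y z x' y' z' N :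
  torus x y z (torus x' y' z' N) = torus (x * x') (y * y') (z * z') N.
Proof. by apply/matrixP => i j; rewrite !mxE; do 2!case: ifP => _; rewrite mulrA. Qed.

Lemma torusZ k x y z N : k *: torus x y z N = torus (k * x) (k * y) (k * z) N.
Proof. by apply/matrixP => i j; rewrite !mxE; do 2!case: ifP => _; rewrite mulrA. Qed.

Lemma span2_change (a b : 'rV[K]_4) p q r s : p * s - q * r != 0 ->
  <<[:: a; b]>>%VS = <<[:: (p *: a + q *: b)%R; (r *: a + s *: b)%R]>>%VS.
Proof.
move=> det0; apply/eqP; rewrite eqEsubv; apply/andP; split; apply/span_subvP => e.
  have aE : a = (s / (p * s - q * r)) *: (p *: a + q *: b) +
      (- q / (p * s - q * r)) *: (r *: a + s *: b).
    by apply/rowP => k; rewrite !mxE; field; exact: det0.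
  have bE : b = (- r / (p * s - q * r)) *: (p *: a + q *: b) +
      (p / (p * s - q * r)) *: (r *: a + s *: b).
    by apply/rowP => k; rewrite !mxE; field; exact: det0.
  by rewrite !inE => /orP[] /eqP ->; [rewrite [X in X \in _]aE | rewrite [X in X \in _]bE]; exact: span2_mem.
by rewrite !inE => /orP[] /eqP ->; exact: span2_mem.
Qed.

End Vanishing.

Section TwelveConics.
Variables (K : numClosedFieldType) (l1 l2 : line K 3) (hskew : skew_lines l1 l2).
Variables (a b c d : 'rV[K]_4).
Hypotheses (hl1 : val l1 = <<[:: a; b]>>%VS) (hl2 : val l2 = <<[:: c; d]>>%VS).
Variables (Q : quadric K) (hQ : smooth22 (form22 a b c d Q)).

Let G : set (quadric K) :=
  [set Q' : quadric K | form22 a b c d Q' != 0 /\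
       infinite_set [set l | [/\ transversal_line l l1, transversal_line l l2,
                                 tangent l Q & tangent l Q']]].

(** A quadric of the set has a form proportional to that of Q, so it lies on one
    of the twelve conics.  Conversely a point of a conic with parameters s, t
    belongs to the set unless s t = 0; at these two points only one diagonal
    block of the matrix survives and the form is zero. *)
Lemma twelve_conics : exists E : 'I_12 -> 'M[K]_(3, 10),
  [/\ forall i, row_free (E i), injective (fun i => conic (E i)),
      G `<=` \bigcup_i conic (E i) & forall i, finite_set (conic (E i) `\` G)].
Proof.
have [p [q [r [s [det0 sD]]]]] := exists_good_basis hQ.
have smoothQ := smooth22_chart det0 hQ.
set a' := p *: a + q *: b in sD smoothQ; set b' := r *: a + s *: b in sD smoothQ.
have hl1' : val l1 = <<[:: a'; b']>>%VS by rewrite hl1; exact: span2_change.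
have Punit := basis_unit hskew hl1' hl2.
pose T (Q' : quadric K) := gram (basis a' b' c d) (quadric_mx Q').
have symT Q' : (T Q')^T = T Q' by exact/gram_sym/quadric_mx_sym.
have form_eq0 Q' : (form22 a b c d Q' = 0) <->
    [/\ tangency0 (T Q') = 0, tangency1 (T Q') = 0 & tangency2 (T Q') = 0].
  rewrite tangency_eq0P /T frame_changeE gram_mul biquadric_frame_change_eq0 //; last first.
    exact/gram_sym/quadric_mx_sym.
  split=> [F0 w x y z|]; last exact: form22_eq0.
  have := form22_eval a b c d Q' (fun i : 'I_4 => nth 0 [:: w; x; y; z] i).
  by rewrite F0 meval0 => <-.
have [N [NP Nnz Ninj Nall]] :=
  symmetric_pencil sD (smooth_coprime smoothQ) (smooth_discriminant_simple smoothQ).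
have /fin_all_exists2[E Efree EP] k : exists2 E : 'M[K]_(3, 10), row_free E &
    forall u v, gram (basis a' b' c d) (sym_mx (conic_vec E u v)) =
      torus (u ^+ 2) (u * v) (v ^+ 2) (N k).
  have [symN _] := NP k; have [Nu Nm Nv] := Nnz k.
  exact: torus_conic.
have E_T k u v (Q' : quadric K) : conic_vec (E k) u v != 0 -> conic_vec (E k) u v \in val Q' ->
    exists2 x : K, x != 0 & T Q' = torus (x * u ^+ 2) (x * (u * v)) (x * v ^+ 2) (N k).
  move=> uv0 uvQ'; have [x x0 xE] := coords_multiple uvQ' uv0; exists x => //.
  by rewrite /T /quadric_mx xE gram_sym_mxZ EP torusZ.
have Einj : injective (fun k => conic (E k)).
  move=> k k' eqE; have v0 : conic_vec (E k) 1 1 != 0 by rewrite conic_vec_eq0 // oner_eq0.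
  have Ek : conic (E k) (mkpoint v0) by exists 1, 1; rewrite memv_line.
  have := Ek; rewrite eqE => -[u [v [uv0 uvp]]].
  have [x x0 TE] := E_T k 1 1 (mkpoint v0) v0 (memv_line _).
  have [y _] := E_T _ _ _ _ uv0 uvp; rewrite TE => {}TE.
  have part al be ga := congr1 (torus al be ga) TE.
  apply: (Ninj k k' (x^-1 * (y * u ^+ 2)) (x^-1 * (y * (u * v)))).
    by have := part x^-1 0 0; rewrite !torus_torus expr1n !mul0r mulr1 mulVf.
  by have := part 0 x^-1 0; rewrite !torus_torus !mulr1 !mul0r mulVf.
have card12 : #|{: 'I_6 * bool}| = 12%N by rewrite card_prod card_ord card_bool.
pose f (i : 'I_12) : 'I_6 * bool := enum_val (cast_ord (esym card12) i).
have f_inj : injective f by move=> i j /enum_val_inj/cast_ord_inj.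
have f_surj k : exists i, f i = k.
  by exists (cast_ord card12 (enum_rank k)); rewrite /f cast_ordK enum_rankK.
exists (fun i => E (f i)); split=> //.
- by move=> i j /Einj/f_inj.
- move=> Q' [F0 inf].
  have [lam lamE] := infinite_common_proportional hskew hl1' hl2 sD smoothQ inf.
  have lam0 : lam != 0.
    apply: contra_neq F0 => lam0; apply/form_eq0.
    by case: lamE; rewrite lam0 !scale0r.
  have [k [x [nu [x0 nu0 TE]]]] := Nall lam (T Q') (symT Q') lam0 lamE.
  have [i fi] := f_surj k; exists i => //; exists x, nu.
  rewrite fi conic_vec_eq0 // (negPf x0); split=> //.
  suff -> : conic_vec (E k) x nu = x *: coords Q' by rewrite rpredZ // coords_mem.
  apply: (gram_sym_mx_inj Punit); rewrite /= EP gram_sym_mxZ -/(quadric_mx Q') -/(T Q') TE torusZ.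
  by congr (torus _ _ _ _); rewrite ?expr2 // mulrCA divff // mulr1.
- move=> i; apply: sub_finite_set (finite_points_through [:: conic_vec (E (f i)) 1 0; conic_vec (E (f i)) 0 1]).
  move=> Q' [[u [v [uv0 uvQ']]] notG].
  have scaled u' v' k' : conic_vec (E (f i)) u v = k' *: conic_vec (E (f i)) u' v' ->
      conic_vec (E (f i)) u' v' != 0 /\ conic_vec (E (f i)) u' v' \in val Q'.
    move=> kE; move: uv0 uvQ'; rewrite kE scaler_eq0 negb_or => /andP[k0 ->].
    by rewrite rpredZeq (negPf k0).
  have [u0|u0] := eqVneq u 0.
    exists (conic_vec (E (f i)) 0 1); first by rewrite !inE eqxx orbT.
    by apply: (scaled _ _ (v ^+ 2)); rewrite -conic_vecZ mulr0 mulr1 u0.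
  have [v0|v0] := eqVneq v 0.
    exists (conic_vec (E (f i)) 1 0); first by rewrite !inE eqxx.
    by apply: (scaled _ _ (u ^+ 2)); rewrite -conic_vecZ mulr0 mulr1 v0.
  case: notG; have [x x0 TE] := E_T _ _ _ _ uv0 uvQ'.
  have [_ [n0 n1 n2]] := NP (f i).
  have [e0 e1 e2] : tangency_scaled ((x * (u * v)) ^+ 2) (T Q) (T Q').
    have [|e0 e1 e2] := @tangency_torus _ (x * u ^+ 2) (x * (u * v)) (x * v ^+ 2) (N (f i)).
      by ring.
    by rewrite TE; split; rewrite ?e0 ?e1 ?e2 ?n0 ?n1 ?n2 scale1r.
  have y0 : (x * (u * v)) ^+ 2 != 0 by rewrite expf_neq0 // !mulf_neq0.
  split; last exact: (proportional_common_infinite hskew hl1' hl2 (And3 e0 e1 e2)).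
  apply/eqP => /form_eq0; rewrite e0 e1 e2 => -[z0 z1 z2].
  have zero (P : {poly K}) : (x * (u * v)) ^+ 2 *: P = 0 -> P = 0.
    by move=> /eqP; rewrite scaler_eq0 (negPf y0) => /eqP.
  by have := sD; rewrite /tangency_discriminant (zero _ z0) (zero _ z1) mul0r scaler0 expr0n subr0 size_poly0.
Qed.

End TwelveConics.

Theorem theorem1 (R : realType) (l1 l2 : line R[i] 3) (hskew : skew_lines l1 l2)
    (a b c d : 'rV[R[i]]_4)
    (hl1 : val l1 = <<[:: a; b]>>%VS) (hl2 : val l2 = <<[:: c; d]>>%VS)
    (Q : quadric R[i]) (hF : form22 a b c d Q != 0)
    (hQ : smooth22 (form22 a b c d Q)) :
  let X := zariski_closure
    [set Q' : quadric R[i] | form22 a b c d Q' != 0 /\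
       infinite_set [set l | [/\ transversal_line l l1, transversal_line l l2,
                                 tangent l Q & tangent l Q']]] in
  [/\ is_curve X, curve_degree X 24 &
      exists C : 'I_12 -> set (quadric R[i]),
        [/\ injective C, forall i, plane_conic (C i) &
            X = \bigcup_i C i]].
Proof.
have [E [Efree Einj subE finE]] := twelve_conics hskew hl1 hl2 hQ.
rewrite (zariski_closure_conics Efree subE finE) => X; split.
- exact: conic_union_curve.
- exact: (conic_union_degree Efree Einj).
- by exists (fun i => conic (E i)); split=> // i; exact: conic_plane.
Qed.
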